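(* Let $L$ be a graded vector space and $\alpha:L\to L$ a linear map of degree $0$. Put $V=sL$ and denote also by $\alpha$ the induced map $s\circ\alpha\circ s^{-1}:V\to V$. Then an $HL_\infty$-algebra structure $(l_k)_{k\ge1}$ on $L$ with respect to $\alpha$ is equivalent to an element $D\in\mathrm{Coder}^{-1}_\alpha(SV)$ with $D\circ D=0$. Precisely, the assignment $(l_k)_{k\ge1}\mapsto D=\sum_{k\ge1}\widetilde{\varrho_k}$ with $\varrho_k=(-1)^{\frac{k(k-1)}2}s\circ l_k\circ(s^{-1})^{\otimes k}$ is a bijection between the set of $HL_\infty$-algebra structures on $L$ with twisting map $\alpha$ and the set of $D\in\mathrm{Coder}^{-1}_\alpha(SV)$ with $D\circ D=0$.
   Context: All vector spaces are over a field of characteristic zero; the Koszul sign rule is used; $\alpha$ is assumed not identically zero. For homogeneous $a_1,\dots,a_n$ and $\sigma\in S_n$, the Koszul sign $\epsilon(\sigma)$ is defined by $a_1\wedge\cdots\wedge a_n=\epsilon(\sigma)\,a_{\sigma(1)}\wedge\cdots\wedge a_{\sigma(n)}$ in the free graded commutative algebra, and $\chi(\sigma)=\mathrm{sgn}(\sigma)\epsilon(\sigma)$. A map $f$ is symmetric (resp. skew-symmetric) if $f(a_{\sigma(1)},\dots,a_{\sigma(n)})$ equals $\epsilon(\sigma)$ (resp. $\chi(\sigma)$) times $f(a_1,\dots,a_n)$. $Sh(i,n-i)$ denotes the $(i,n-i)$-unshuffles: $\sigma\in S_n$ with $\sigma(1)<\cdots<\sigma(i)$ and $\sigma(i+1)<\cdots<\sigma(n)$.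 $HL_\infty$-algebra $(L,l_k,\alpha)$: a graded vector space $L$ with skew-symmetric multilinear maps $l_k:L^{\otimes k}\to L$ of degree $k-2$ ($k\ge1$) and a degree $0$ linear map $\alpha:L\to L$ with $\alpha\circ l_k=l_k\circ\alpha^{\otimes k}$, such that for all $n\ge1$ $$\sum_{i+j=n+1}\ \sum_{\sigma\in Sh(i,n-i)}\chi(\sigma)(-1)^{i(j-1)}\,l_j\big(l_i(a_{\sigma(1)},\dots,a_{\sigma(i)}),\alpha^{i-1}a_{\sigma(i+1)},\dots,\alpha^{i-1}a_{\sigma(n)}\big)=0 .$$ Suspension: $(sL)_i=L_{i-1}$; $s$ has degree $+1$, $s^{-1}$ degree $-1$. Twisted coderivations: $SV=\oplus_{k\ge0}S^k(V)$ is the free graded commutative algebra with product $\wedge$. For a homogeneous linear $\varrho:S^n(V)\to V$ with $\alpha(\varrho(v_1\wedge\cdots\wedge v_n))=\varrho(\alpha v_1\wedge\cdots\wedge\alpha v_n)$ define $\widetilde\varrho:SV\to SV$ to be $0$ on $S^k(V)$ for $k<n$, and for $k\ge n$ $$\widetilde\varrho(v_1\wedge\cdots\wedge v_k)=\sum_{\sigma\in Sh(n,k-n)}\epsilon(\sigma)\,\varrho(v_{\sigma(1)}\wedge\cdots\wedge v_{\sigma(n)})\wedge\alpha^{n-1}v_{\sigma(n+1)}\wedge\cdots\wedge\alpha^{n-1}v_{\sigma(k)} .$$ $\mathrm{Coder}^p_\alpha(SV)$ is the space of all $D=\sum_{n\ge1}\widetilde{\varrho_n}$ with each $\varrho_n:S^n(V)\to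 V$ of degree $p$ commuting with $\alpha$ in this sense; symmetric maps $V^{\otimes n}\to V$ are identified with linear maps $S^n(V)\to V$. $D\circ D$ is composition of maps. *)

(* Defs.v *)
From HB Require Import structures.
From mathcomp Require Import all_boot all_order all_algebra fingroup perm.
From mathcomp Require Import finmap.
From mathcomp Require Import boolp classical_sets functions cardinality fsbigop.
From mathcomp Require Import generic_quotient ring_quotient.
From mathcomp.multinomials Require Import monalg.

Set Implicit Arguments.
Unset Strict Implicit.
Unset Printing Implicit Defensive.

Import GRing.Theory.
Local Open Scope classical_set_scope.
Local Open Scope ring_scope.
Local Open Scope quotient_scope.

(* ------------------------------------------------------------------------ *)
(* A Z-graded vector space is a vector space with an internal direct sum
   decomposition, given by the projections [gcomp d] onto its degree-[d]
   components. *)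
Record gradedSpace (K : fieldType) := GradedSpace {
  gcarrier :> lmodType K;
  gcomp : int -> {linear gcarrier -> gcarrier};
  gcomp_ortho : forall d e v,
    gcomp d (gcomp e v) = if d == e then gcomp e v else 0;
  gcomp_fin : forall v, finite_set [set d | gcomp d v != 0];
  gcomp_sum : forall v, \sum_(d \in [set: int]) gcomp d v = v
}.

Definition homog (K : fieldType) (L : gradedSpace K) (d : int) (v : L) : Prop :=
  gcomp L d v = v.

(* (sL)_i = L_(i-1): same underlying space, shifted grading. *)
Section Suspension.
Context (K : fieldType) (L : gradedSpace K).

Fact susp_ortho (d e : int) (v : L) :
  gcomp L (d - 1) (gcomp L (e - 1) v) = if d == e then gcomp L (e - 1) v else 0.
Proof. by rewrite gcomp_ortho (inj_eq (addIr _)). Qed.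

Fact susp_fin (v : L) : finite_set [set d : int | gcomp L (d - 1) v != 0].
Proof.
apply: (@finite_preimage _ _ [set d : int | gcomp L d v != 0]
          (fun d : int => d - 1)).
  by move=> ? ? _ _; apply: addIr.
exact: gcomp_fin.
Qed.

Fact susp_sum (v : L) : \sum_(d \in [set: int]) gcomp L (d - 1) v = v.
Proof.
rewrite -[RHS](gcomp_sum v); apply/esym/(@reindex_fsbigT _ _ _ _ _ _ (gcomp L ^~ v)).
by exists (fun d => d + 1) => d; rewrite ?addrK ?subrK.
Qed.

Definition susp : gradedSpace K :=
  @GradedSpace K L (fun d => gcomp L (d - 1)) susp_ortho susp_fin susp_sum.

Definition s : L -> susp := id.
Definition sinv : susp -> L := id.
End Suspension.

(* ------------------------------------------------------------------------ *)
(* [koszul d sigma] is the sign eps(sigma) in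
     a_1 /\ ... /\ a_n = eps(sigma) a_sigma(1) /\ ... /\ a_sigma(n)
   for elements a_i of degree d_i: each inversion of sigma contributes the sign
   of exchanging the two elements concerned. *)
Section Signs.
Context (K : fieldType) (n : nat).

Definition koszul (d : 'I_n -> int) (sigma : 'S_n) : K :=
  \prod_(i < n) \prod_(j < n | (i < j)%N && (sigma j < sigma i)%N)
    (-1) ^ (d (sigma i) * d (sigma j)).

Definition skoszul (d : 'I_n -> int) (sigma : 'S_n) : K :=
  (-1) ^+ odd_perm sigma * koszul d sigma.

(* Sh(i, n - i) *)
Definition unshuffle (i : nat) (sigma : 'S_n) : bool :=
  [forall p : 'I_n, forall q : 'I_n,
    (p < q)%N && ((q < i)%N || (i <= p)%N) ==> (sigma p < sigma q)%N].
End Signs.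

(* ------------------------------------------------------------------------ *)
Section MultiMaps.
Context (K : fieldType) (L : gradedSpace K).

Definition multimap (k : nat) := ('I_k -> L) -> L.

Definition multilinear k (f : multimap k) : Prop :=
  forall (i : 'I_k) (a : 'I_k -> L) (c : K) (x y : L),
    f [eta a with i |-> c *: x + y] =
    c *: f [eta a with i |-> x] + f [eta a with i |-> y].

Definition homogs k (d : 'I_k -> int) (a : 'I_k -> L) : Prop :=
  forall i, homog (d i) (a i).

Definition has_degree k (p : int) (f : multimap k) : Prop :=
  forall d a, homogs d a -> homog (\sum_(i < k) d i + p) (f a).

Definition symmetric_map k (f : multimap k) : Prop :=
  forall d a (sigma : 'S_k), homogs d a ->
    f (a \o sigma) = koszul K d sigma *: f a.

Definition skew_symmetric_map k (f : multimap k) : Prop :=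
  forall d a (sigma : 'S_k), homogs d a ->
    f (a \o sigma) = skoszul K d sigma *: f a.

Definition commutes_with (alpha : L -> L) k (f : multimap k) : Prop :=
  forall a, alpha (f a) = f (alpha \o a).

(* The first [k] entries of the list [w], as a [k]-tuple of arguments. *)
Definition args (w : seq L) (k : nat) : 'I_k -> L := fun p => w`_p.
End MultiMaps.
Arguments args {K L} w k p : rename.

(* ------------------------------------------------------------------------ *)
Section HLinfinity.
Context (K : fieldType) (L : gradedSpace K) (alpha : L -> L).

Definition HL_identity (l : forall k, multimap L k) (n : nat) : Prop :=
  forall (d : 'I_n -> int) (a : 'I_n -> L), homogs d a ->
  \sum_(1 <= i < n.+1) \sum_(sigma : 'S_n | unshuffle i sigma)
    (let j := (n.+1 - i)%N in
     let w := codom (a \o sigma) in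
     (skoszul K d sigma * (-1) ^+ (i * (j - 1))) *:
       l j (args (l i (args w i) :: map (iter (i - 1) alpha) (drop i w)) j))
  = 0.

(* The operations l_k are indexed by k >= 1; the unused l_0 is fixed to 0, so
   that a structure is determined by (l_k)_(k >= 1). *)
Definition HLinf_structure (l : forall k, multimap L k) : Prop :=
  (forall a, l 0 a = 0) /\
  (forall k, (0 < k)%N ->
    [/\ multilinear (l k), has_degree (k%:Z - 2) (l k),
        skew_symmetric_map (l k), commutes_with alpha (l k)
      & HL_identity l k]).
End HLinfinity.

(* ------------------------------------------------------------------------ *)
(* SV: the free associative algebra K<V> on the set V, modulo the two-sided
   ideal generated by the linear relations (which give the tensor algebra) and
   by the graded commutativity relations. *)
Section SymmetricAlgebra.
Context (K : fieldType) (V : gradedSpace K).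

Local Notation KV := {malg K[{fmonom V}]}.
Local Notation gen v := (<< fmu (v : V) >> : KV).

Inductive SVideal : KV -> Prop :=
| SVideal0 : SVideal 0
| SVidealD x y : SVideal x -> SVideal y -> SVideal (x + y)
| SVidealM x y z : SVideal y -> SVideal (x * y * z)
| SVideal_lin (c : K) (u v : V) :
    SVideal (gen (c *: u + v) - (c *: gen u + gen v))
| SVideal_comm (d e : int) (u v : V) : homog d u -> homog e v ->
    SVideal (gen u * gen v - (-1) ^ (d * e) *: (gen v * gen u)).

Definition SVideal_pred : {pred KV} := fun x => `[< SVideal x >].

Fact SVideal_zmod_closed : zmod_closed SVideal_pred.
Proof.
split; first by apply/asboolP; constructor.
move=> x y /asboolP Ix /asboolP Iy; apply/asboolP; apply: SVidealD => //.
by rewrite -[- y]mulr1 -[y]mul1r -mulNr; apply: SVidealM.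
Qed.

HB.instance Definition _ :=
  GRing.isZmodClosed.Build KV SVideal_pred SVideal_zmod_closed.

Definition SV : Type := Quotient.quot SVideal_pred.
HB.instance Definition _ := GRing.Zmodule.on SV.

Definition SVpi (x : KV) : SV := \pi_(Quotient.quot SVideal_pred) x.

Definition SVone : SV := SVpi 1.
Definition SVmul (x y : SV) : SV :=
  SVpi (repr (x : Quotient.quot SVideal_pred) * repr (y : Quotient.quot SVideal_pred)).
Definition SVscale (c : K) (x : SV) : SV :=
  SVpi (c *: repr (x : Quotient.quot SVideal_pred)).

Fact SVpiP x y : SVideal (x - y) <-> SVpi x = SVpi y.
Proof.
rewrite /SVpi; split.
  by move=> Ixy; apply/eqmodP; rewrite /= Quotient.equivE; apply/asboolP.
by move/eqmodP; rewrite /= Quotient.equivE => /asboolP.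
Qed.

Fact SVreprK (x : SV) : SVpi (repr (x : Quotient.quot SVideal_pred)) = x.
Proof. exact: reprK. Qed.

Fact SVpiD x y : SVpi (x + y) = SVpi x + SVpi y.
Proof. exact: (raddfD (\pi_(Quotient.quot SVideal_pred))). Qed.

Fact SVpiM x y : SVpi (x * y) = SVmul (SVpi x) (SVpi y).
Proof.
apply/SVpiP; set x' := repr _; set y' := repr _.
have Ix : SVideal (x - x') by apply/SVpiP; rewrite SVreprK.
have Iy : SVideal (y - y') by apply/SVpiP; rewrite SVreprK.
have -> : x * y - x' * y' = 1 * (x - x') * y + x' * (y - y') * 1.
  by rewrite mul1r mulr1 mulrBl mulrBr addrA subrK.
by apply: SVidealD; apply: SVidealM.
Qed.

Fact SVpiZ c x : SVpi (c *: x) = SVscale c (SVpi x).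
Proof.
apply/SVpiP; set x' := repr _.
have Ix : SVideal (x - x') by apply/SVpiP; rewrite SVreprK.
by rewrite -scalerBr -[x - x']mul1r scalerAl -[_ * _]mulr1; apply: SVidealM.
Qed.

Fact SV_ind (P : SV -> Prop) : (forall x, P (SVpi x)) -> forall x, P x.
Proof. by move=> H x; rewrite -[x]SVreprK. Qed.

Fact SVmulA : associative SVmul.
Proof.
elim/SV_ind=> x; elim/SV_ind=> y; elim/SV_ind=> z.
by rewrite -!SVpiM mulrA.
Qed.
Fact SVmul1 : left_id SVone SVmul.
Proof. by elim/SV_ind=> x; rewrite -SVpiM mul1r. Qed.
Fact SVmulr1 : right_id SVone SVmul.
Proof. by elim/SV_ind=> x; rewrite -SVpiM mulr1. Qed.
Fact SVmulDl : left_distributive SVmul +%R.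
Proof.
elim/SV_ind=> x; elim/SV_ind=> y; elim/SV_ind=> z.
by rewrite -SVpiD -!SVpiM -SVpiD mulrDl.
Qed.
Fact SVmulDr : right_distributive SVmul +%R.
Proof.
elim/SV_ind=> x; elim/SV_ind=> y; elim/SV_ind=> z.
by rewrite -SVpiD -!SVpiM -SVpiD mulrDr.
Qed.
HB.instance Definition _ := GRing.Zmodule_isPzRing.Build SV
  SVmulA SVmul1 SVmulr1 SVmulDl SVmulDr.

Fact SVideal_aug x : SVideal x -> x@_(fmone V) = 0.
Proof.
elim=> {x} [|x y _ IHx _ IHy|x y z _ IHy|c u v|d e u v _ _].
- exact: mcoeff0.
- by rewrite mcoeffD IHx IHy addr0.
- have mM (a b : KV) : (a * b)@_(fmone V) = a@_(fmone V) * b@_(fmone V) by exact: rmorphM.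
  by rewrite !mM IHy mulr0 mul0r.
- by rewrite mcoeffB mcoeffD mcoeffZ !mcoeffU1 !fmP !fmoneE !fmuE /= mulr0 addr0 subr0.
- have mM (a b : KV) : (a * b)@_(fmone V) = a@_(fmone V) * b@_(fmone V) by exact: rmorphM.
  by rewrite mcoeffB mcoeffZ !mM !mcoeffU1 !fmP !fmoneE !fmuE /= !mulr0 subr0.
Qed.

Fact SVone_neq0 : 1 != 0 :> SV.
Proof.
apply/eqP => e; have /SVpiP : SVpi 1 = SVpi 0.
  by rewrite [RHS](raddf0 (\pi_(Quotient.quot SVideal_pred))); apply: e.
rewrite subr0 => /SVideal_aug.
by rewrite mcoeff1 eqxx => /eqP; rewrite oner_eq0.
Qed.
HB.instance Definition _ := GRing.PzSemiRing_isNonZero.Build SV SVone_neq0.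

Fact SVscaleA c d x : SVscale c (SVscale d x) = SVscale (c * d) x.
Proof. by elim/SV_ind: x => x; rewrite -!SVpiZ scalerA. Qed.
Fact SVscale1 : left_id 1 SVscale.
Proof. by elim/SV_ind=> x; rewrite -SVpiZ scale1r. Qed.
Fact SVscaleDr : right_distributive SVscale +%R.
Proof.
by move=> c; elim/SV_ind=> x; elim/SV_ind=> y; rewrite -SVpiD -!SVpiZ -SVpiD scalerDr.
Qed.
Fact SVscaleDl x : {morph SVscale^~ x : c d / c + d}.
Proof. by elim/SV_ind: x => x c d; rewrite -!SVpiZ -SVpiD scalerDl. Qed.
HB.instance Definition _ := GRing.Zmodule_isLmodule.Build K SV
  SVscaleA SVscale1 SVscaleDr SVscaleDl.

Fact SVscaleAl (c : K) (x y : SV) : c *: (x * y) = (c *: x) * y.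
Proof.
elim/SV_ind: x => x; elim/SV_ind: y => y.
by rewrite /GRing.scale /GRing.mul /= -SVpiM -!SVpiZ -SVpiM scalerAl.
Qed.
HB.instance Definition _ := GRing.Lmodule_isLalgebra.Build K SV SVscaleAl.

Fact SVscaleAr (c : K) (x y : SV) : c *: (x * y) = x * (c *: y).
Proof.
elim/SV_ind: x => x; elim/SV_ind: y => y.
rewrite /GRing.scale /GRing.mul /= -SVpiM -!SVpiZ -SVpiM; congr SVpi.
apply/malgP => k; rewrite mcoeffZ (mcoeffMlw _ (fsubset_refl _) (fsubset_refl _)).
rewrite (mcoeffMlw _ (fsubset_refl _) (msuppZ_le _ _)) mulr_sumr.
apply: eq_bigr => k1 _; rewrite mulr_sumr; apply: eq_bigr => k2 _.
by rewrite mcoeffZ mulrCA mulrnAr.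
Qed.
HB.instance Definition _ := GRing.Lalgebra_isAlgebra.Build K SV SVscaleAr.

(* The canonical inclusion V = S^1(V) -> SV; the product /\ of SV is [*%R]. *)
Definition iota (v : V) : SV := SVpi (gen v).

End SymmetricAlgebra.

(* ------------------------------------------------------------------------ *)
Section TwistedCoderivations.
Context (K : fieldType) (V : gradedSpace K) (alpha : V -> V).
Local Notation SV := (SV V).

Definition tilde_spec (n : nat) (rho : multimap V n) (T : SV -> SV) : Prop :=
  linear T /\
  forall (k : nat) (d : 'I_k -> int) (v : 'I_k -> V), homogs d v ->
    T (\prod_(i < k) iota (v i)) =
    if (k < n)%N then 0 else
    \sum_(sigma : 'S_k | unshuffle n sigma)
      koszul K d sigma *:
        (iota (rho (args (codom (v \o sigma)) n)) *
         \prod_(i < k | (n <= i)%N) iota (iter (n - 1) alpha (v (sigma i)))).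

(* The linear map with the prescribed values on products of homogeneous
   elements.  These products span SV, so there is at most one; for symmetric
   multilinear [rho] and linear [alpha] of degree 0 the prescription respects
   the relations of SV, so there is one. *)
Definition tilde (n : nat) (rho : multimap V n) : SV -> SV :=
  xget (fun=> 0) [set T | tilde_spec rho T].

(* sum_(n >= 1): on each element of SV only finitely many terms are nonzero. *)
Definition sum_tilde (rho : forall n, multimap V n) : SV -> SV :=
  fun x => \sum_(n \in [set n : nat | (0 < n)%N]) tilde (rho n) x.

Definition Coder (p : int) : set (SV -> SV) :=
  [set D | exists2 rho : forall n, multimap V n,
     forall n, (0 < n)%N ->
       [/\ multilinear (rho n), symmetric_map (rho n),
           has_degree p (rho n) & commutes_with alpha (rho n)]
     & D = sum_tilde rho].
End TwistedCoderivations.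

(* ------------------------------------------------------------------------ *)
Section Desuspension.
Context (K : fieldType) (L : gradedSpace K).

(* v |-> (-1)^|v| v on homogeneous elements *)
Definition parity (V : gradedSpace K) (v : V) : V :=
  \sum_(d \in [set: int]) ((-1) ^ d : K) *: gcomp V d v.

(* (s^-1)^{\otimes k}: by the Koszul rule, the copies of s^-1 in positions
   i+1, ..., k-1 (counting from 0) move past v_i, whence the sign
   (-1)^((k-1-i)|v_i|). *)
Definition sinv_tensor k (v : 'I_k -> susp L) : 'I_k -> L :=
  fun i => sinv (iter (k - 1 - i) (@parity (susp L)) (v i)).

Definition rho_of (l : forall k, multimap L k) : forall k, multimap (susp L) k :=
  fun k v => (-1) ^+ (k * (k - 1))./2 *: s (l k (sinv_tensor v)).
End Desuspension.

(* Main.v *)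
Require Import Defs.
From mathcomp Require Import all_boot all_order all_algebra fingroup perm.
From mathcomp Require Import finmap zify.
From mathcomp Require Import boolp classical_sets functions cardinality fsbigop.
From mathcomp.multinomials Require Import monalg.

Set Implicit Arguments.
Unset Strict Implicit.
Unset Printing Implicit Defensive.

Import GRing.Theory.
Local Open Scope classical_set_scope.
Local Open Scope ring_scope.
Local Notation iota := Defs.iota.

(* Put V = sL. On words in homogeneous vectors, a sum over unshuffles is the
   unshuffle coproduct [sh], defined by recursion on the word: each letter goes
   to the front or to the back factor, at the cost of a sign for passing the
   letters already in front. It is coassociative and graded cocommutative.

   If D is the sum of the coderivations of a family (rho_n), then D \o D applied
   to v_1 ... v_k has two kinds of terms. Those in which the outer rho_m does not
   use the output of the inner rho_n cancel in pairs by cocommutativity, both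
   maps being odd and commuting with alpha. The others add up, by
   coassociativity, to the twisted coderivation of the map J whose value on a
   word Y is the sum of rho_m(rho_n(A), alpha^(n-1) C) over the unshuffles
   (A, C) of Y. Projecting to S^1(V) gives D \o D = 0 iff J = 0, and also shows
   that D determines the rho_n. Finally the sign of (s^-1)^{\otimes k} turns
   Koszul signs into skew Koszul signs (decalage), so that J = 0 is the
   HL-infinity identity.

   Each coderivation must also be shown to exist on SV, which is a quotient of
   a free algebra on the underlying set of V: the recursion for [sh] makes sense
   for arbitrary vectors split into even and odd parts, and the resulting
   function of words is multilinear and graded symmetric, hence factors. *)

(** * Linear maps *)

Section LinearMaps.
Context (K : fieldType) (M N : lmodType K) (T : M -> N).
Hypothesis linT : linear T.

Lemma lin_0 : T 0 = 0.
Proof. by have := linT (-1) 0 0; rewrite scaler0 addr0 scaleN1r addNr. Qed.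

Lemma lin_D x y : T (x + y) = T x + T y.
Proof. by rewrite -[x]scale1r linT !scale1r. Qed.

Lemma lin_Z c x : T (c *: x) = c *: T x.
Proof. by rewrite -[c *: x]addr0 linT lin_0 addr0. Qed.

Lemma lin_eq0 c x y : T x = 0 -> T y = 0 -> T (c *: x + y) = 0.
Proof. by move=> Tx Ty; rewrite linT Tx Ty scaler0 addr0. Qed.

End LinearMaps.

(** * Unshuffles and signs *)

Section Inversions.
Context (R : comPzRingType) (X : Type).
Implicit Types (kappa : X -> X -> R).

(** The weight [kappa] is left arbitrary because the Koszul sign, its skew version and sgn are all
    products over inversions; one recursion serves the three. *)
Definition inv_prod kappa n (a : 'I_n -> X) (sigma : 'S_n) : R :=
  \prod_(i < n) \prod_(j < n | (i < j)%N && (sigma j < sigma i)%N)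
    kappa (a (sigma i)) (a (sigma j)).

Lemma codom_ordS n (a : 'I_n.+1 -> X) :
  codom a = a ord0 :: codom (a \o lift ord0).
Proof. by rewrite !codomE enum_ordSl /= -map_comp. Qed.

Lemma nth_codom_ord n (a : 'I_n -> X) x0 (i : 'I_n) : nth x0 (codom a) i = a i.
Proof. by rewrite codomE (nth_map i) ?size_enum_ord // nth_ord_enum. Qed.

Lemma size_codom_ord n (a : 'I_n -> X) : size (codom a) = n.
Proof. by rewrite size_codom card_ord. Qed.

Lemma ord_codom x0 k (w : seq X) :
  size w = k -> codom (fun i : 'I_k => nth x0 w i) = w.
Proof.
move=> sw; apply: (@eq_from_nth _ x0); rewrite size_codom_ord // => i ik.
by rewrite (nth_codom_ord _ _ (Ordinal ik)).
Qed.

(** The permutation [lift_perm j ord0 sigma] takes the value 0 at j, so the first letter lands at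
    position j of the rearranged tail. *)
Lemma codom_lift_perm n (a : 'I_n.+1 -> X) (j : 'I_n.+1) (sigma : 'S_n) :
  let w := codom (a \o lift ord0 \o sigma) in
  codom (a \o lift_perm j ord0 sigma) = take j w ++ a ord0 :: drop j w.
Proof.
move=> w; have sw : size w = n by rewrite size_codom_ord.
have jn : (j <= n)%N by rewrite -ltnS.
have st : size (take j w) = j by rewrite size_takel ?sw.
apply: (@eq_from_nth _ (a ord0)).
  by rewrite size_cat /= st size_drop sw size_codom_ord addnS subnKC.
move=> i; rewrite size_codom_ord => ilt.
have [o ->] : exists o : 'I_n.+1, i = o by exists (Ordinal ilt).
rewrite nth_codom_ord nth_cat st /=.
case: (unliftP j o) => [p|] ->; last by rewrite lift_perm_id ltnn subnn.
rewrite lift_perm_lift /= /bump; case: (leqP j p) => jp.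
  by rewrite add1n ltnNge leqW //= subSn //= nth_drop subnKC // nth_codom_ord.
by rewrite add0n jp nth_take // nth_codom_ord.
Qed.

(** As 0 is the least value, the position j taking it is inverted with exactly the positions before
    j; all other inversions are those of [sigma]. *)
Lemma inv_prod_lift kappa n (a : 'I_n.+1 -> X) (j : 'I_n.+1) (sigma : 'S_n) :
  inv_prod kappa a (lift_perm j ord0 sigma) =
  (\prod_(y <- take j (codom (a \o lift ord0 \o sigma))) kappa y (a ord0)) *
  inv_prod kappa (a \o lift ord0) sigma.
Proof.
rewrite /inv_prod (bigD1_ord j) //= [X in X * _]big_pred0 ?mul1r; last first.
  by move=> q; rewrite lift_perm_id ltn0 andbF.
have -> : \prod_(y <- take j (codom (a \o lift ord0 \o sigma))) kappa y (a ord0)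
        = \prod_(p < n | (p < j)%N) kappa (a (lift ord0 (sigma p))) (a ord0).
  have jn : (j <= n)%N by rewrite -ltnS.
  rewrite (big_nth (a ord0)) size_takel ?size_codom_ord // big_mkord.
  rewrite (big_ord_widen_cond n xpredT (fun i => kappa (nth (a ord0)
     (take j (codom (a \o lift ord0 \o sigma))) i) (a ord0))) //.
  by apply: eq_bigr => p pj; rewrite nth_take // nth_codom_ord.
rewrite [X in X * _]big_mkcond -big_split /=; apply: eq_bigr => p _.
rewrite lift_perm_lift big_mkcond (bigD1_ord j) //= lift_perm_id.
congr (_ * _).
  congr (if _ then _ else _); rewrite /= andbT /bump.
  by case: (leqP j p) => jp; rewrite ?add0n ?jp // add1n ltnNge leqW.
rewrite [RHS]big_mkcond; apply: eq_bigr => q _.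
rewrite lift_perm_lift /=; congr (if _ then _ else _); congr (_ && _).
by rewrite ltnNge leq_bump2 -ltnNge.
Qed.

Lemma inv_prod1 kappa n (a : 'I_n -> X) : inv_prod kappa a 1%g = 1.
Proof.
apply: big1 => i _; rewrite big_pred0 // => j.
by rewrite !permE; case: ltngtP.
Qed.

End Inversions.

(** Injectivity plus the count (n+1) n! = (n+1)!. The inductions on permutations rest on this
    decomposition, which matches adding a first letter to a word. *)
Lemma lift_perm_bij n :
  bijective (fun p : 'I_n.+1 * 'S_n => lift_perm p.1 ord0 p.2).
Proof.
apply: inj_card_bij => [[j s] [j' s'] /= e|].
  have ej : j = j'.
    by apply: (@perm_inj _ (lift_perm j ord0 s)); rewrite {2}e !lift_perm_id.
  rewrite -ej in e *; congr (_, _); apply/permP => k.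
  by apply: (@lift_inj _ ord0); rewrite -!(lift_perm_lift j) e.
by rewrite card_prod card_ord !card_Sn.
Qed.

Lemma big_lift_perm (M : nmodType) n (F : 'S_n.+1 -> M) :
  \sum_sigma F sigma =
  \sum_(j < n.+1) \sum_(sigma : 'S_n) F (lift_perm j ord0 sigma).
Proof.
rewrite (reindex _ (onW_bij _ (lift_perm_bij n))).
by rewrite (pair_big xpredT xpredT (fun j s => F (lift_perm j ord0 s))).
Qed.

Lemma lift_permP n (sigma : 'S_n.+1) :
  exists j sigma', sigma = lift_perm j ord0 sigma'.
Proof.
have [g _ gK] := lift_perm_bij n.
by exists (g sigma).1, (g sigma).2; rewrite gK.
Qed.

Lemma unshuffleP n i (sigma : 'S_n) :
  reflect (forall p q : 'I_n, (p < q)%N -> (q < i)%N || (i <= p)%N ->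
             (sigma p < sigma q)%N)
          (unshuffle i sigma).
Proof.
apply: (iffP forallP) => [U p q pq c | U p].
  by have /forallP/(_ q) := U p; rewrite pq c.
by apply/forallP => q; apply/implyP => /andP[pq c]; apply: U.
Qed.

(* An unshuffle takes its value 0 at the start of one of its two blocks. *)
Lemma unshuffle_lift n i j (sigma : 'S_n) :
  unshuffle i (lift_perm j ord0 sigma) =
  if (j == ord0) && (0 < i)%N then unshuffle i.-1 sigma
  else (j == i :> nat) && unshuffle i sigma.
Proof.
have lt0 p q : (lift ord0 (sigma p) < lift ord0 (sigma q))%N =
    (sigma p < sigma q)%N by [].
case: ifP => [/andP[/eqP -> i0] | ji0].
  apply/unshuffleP/unshuffleP => U p q.
    move=> pq c; rewrite -lt0 -!(lift_perm_lift ord0); apply: U => //=.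
    by rewrite /bump /=; lia.
  case: (unliftP ord0 q) => [q'|] -> //; case: (unliftP ord0 p) => [p'|] ->.
    by rewrite !lift_perm_lift lt0 /= /bump /= => pq c; apply: U; lia.
  by rewrite lift_perm_lift lift_perm_id.
have [ji|ji] /= := eqVneq (j : nat) i; last first.
  apply/unshuffleP => U; have := ltngtP (j : nat) i; case=> [lt|gt|/eqP].
  - have j0 : (0 < j)%N.
      rewrite lt0n; apply: contraFN ji0 => /eqP j0.
      by apply/andP; split; [exact/eqP/val_inj | rewrite (leq_ltn_trans _ lt)].
    by have := U ord0 j j0; rewrite lt lift_perm_id ltn0 => /(_ isT).
  - have ilt : (i < n.+1)%N by apply: (ltn_trans gt).
    by have := U (Ordinal ilt) j gt; rewrite /= leqnn orbT lift_perm_id => /(_ isT).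
  - exact/negP.
apply/unshuffleP/unshuffleP => U p q.
  move=> pq c; rewrite -lt0 -!(lift_perm_lift j); apply: U => //=;
  by rewrite /bump /=; lia.
case: (unliftP j q) => [q'|] ->; case: (unliftP j p) => [p'|] ->.
- by rewrite !lift_perm_lift lt0 /= /bump /= => pq c; apply: U; lia.
- by rewrite lift_perm_lift lift_perm_id.
- by rewrite /= /bump; lia.
- by rewrite ltnn.
Qed.

(** * The unshuffle coproduct *)

Section Shuffles.
Context (K : fieldType) (X : eqType) (kappa : X -> X -> K).

(* The unshuffle coproduct: [sh w F] sums F over all splittings of w into two
   subwords, moving x past the elements y of the first one at the cost
   of kappa y x. *)
Fixpoint sh (M : lmodType K) (w : seq X) (F : seq X -> seq X -> M) : M :=
  if w is x :: w' then
    sh w' (fun A B => F (x :: A) B) +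
    sh w' (fun A B => (\prod_(y <- A) kappa y x) *: F A (x :: B))
  else F [::] [::].

Section Codomain.
Context (M : lmodType K).
Implicit Types (F G : seq X -> seq X -> M) (w A B : seq X).

Lemma eq_sh w F G :
  (forall A B, perm_eq (A ++ B) w -> F A B = G A B) -> sh w F = sh w G.
Proof.
elim: w F G => [|x w IH] F G FG /=; first exact: FG.
congr (_ + _); apply: IH => A B AB; first by apply: FG; rewrite /= perm_cons.
by congr (_ *: _); apply: FG; rewrite perm_catC /= perm_cons perm_catC.
Qed.

Lemma sh0 w F : (forall A B, perm_eq (A ++ B) w -> F A B = 0) -> sh w F = 0.
Proof.
move=> F0; rewrite (eq_sh (G := fun _ _ => 0)) //; elim: w {F F0} => //= x w IH.
rewrite IH add0r -[RHS]IH; apply: eq_sh => A B _; exact: scaler0.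
Qed.

Lemma sh_linear w (c : K) F G :
  sh w (fun A B => c *: F A B + G A B) = c *: sh w F + sh w G.
Proof.
elim: w F G => [|x w IH] F G //=.
rewrite scalerDr addrACA -!IH; congr (_ + _); apply: eq_sh => A B _.
by rewrite scalerDr !scalerA mulrC.
Qed.

Lemma shZ w (c : K) F : sh w (fun A B => c *: F A B) = c *: sh w F.
Proof.
have := sh_linear w c F (fun _ _ => 0); rewrite (@sh0 w (fun _ _ => 0)) // addr0.
by move=> <-; apply: eq_sh => A B _; rewrite addr0.
Qed.

Lemma shD w F G : sh w (fun A B => F A B + G A B) = sh w F + sh w G.
Proof.
rewrite -[sh w F]scale1r -sh_linear.
by apply: eq_sh => A B _; rewrite scale1r.
Qed.

Lemma sh_sum w (I : Type) (r : seq I) (P : pred I) (F : I -> seq X -> seq X -> M) :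
  sh w (fun A B => \sum_(i <- r | P i) F i A B) = \sum_(i <- r | P i) sh w (F i).
Proof.
elim: r => [|i r IH].
  by rewrite big_nil; apply: sh0 => A B _; rewrite big_nil.
rewrite big_cons -IH; case: ifP => Pi; first rewrite -shD;
  by apply: eq_sh => A B _; rewrite big_cons Pi.
Qed.

(** The counit law: the only splitting with empty back factor keeps every letter in front, at cost
    1. *)
Lemma sh_nilr w F : sh w (fun A B => if B is [::] then F A B else 0) = F w [::].
Proof.
elim: w F => //= x w IH F; rewrite (IH (fun A => F (x :: A))).
by rewrite [X in _ + X]sh0 ?addr0 // => A B _; rewrite scaler0.
Qed.

End Codomain.

Lemma sh_comp (M N : lmodType K) (T : M -> N) w F :
  linear T -> T (sh w F) = sh w (fun A B => T (F A B)).
Proof.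
move=> linT; elim: w F => //= x w IH F; rewrite (lin_D linT) !IH.
by congr (_ + _); apply: eq_sh => A B _; rewrite (lin_Z linT).
Qed.

(** Both sides run over splittings into three subwords. A letter sent to the last one passes the
    letters of the first two, and this cost is multiplicative and independent of their order. *)
Lemma sh_assoc (M : lmodType K) w (F : seq X -> seq X -> seq X -> M) :
  sh w (fun A B => sh A (fun C D => F C D B)) =
  sh w (fun A B => sh B (fun C D => F A C D)).
Proof.
elim: w F => //= x w IH F; rewrite shD (IH (fun C => F (x :: C))) -addrA.
congr (_ + _).
transitivity (sh w (fun A B => sh B (fun C D =>
    (\prod_(y <- A) kappa y x) *: F A (x :: C) D +
    ((\prod_(y <- A) kappa y x) * (\prod_(y <- C) kappa y x))
        *: F A C (x :: D)))).
  rewrite -(IH (fun A C D => _ *: F A (x :: C) D + _ *: F A C (x :: D))).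
  rewrite -shD; apply: eq_sh => A B _; rewrite -shZ -shD.
  apply: eq_sh => C D CD; congr (_ + _ *: _).
  by rewrite -(perm_big _ CD) big_cat.
apply: eq_sh => A B _; rewrite -shD -shZ; apply: eq_sh => C D _.
by rewrite scalerDr scalerA.
Qed.

Lemma sh_map (M : lmodType K) (f : X -> X) w (F : seq X -> seq X -> M) :
  (forall x y, kappa (f y) (f x) = kappa y x) ->
  sh (map f w) F = sh w (fun A B => F (map f A) (map f B)).
Proof.
move=> kf; elim: w F => //= x w IH F; rewrite !IH.
congr (_ + _); apply: eq_sh => A B _; rewrite big_map.
by under eq_bigr do rewrite kf.
Qed.

(** Induction on n: in an unshuffle the value 0 heads the front block or the back block, and these
    cases are the two summands in the recursion of [sh]. *)
Lemma shuffle_sum (M : lmodType K) n (a : 'I_n -> X) i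
    (F : seq X -> seq X -> M) : (i <= n)%N ->
  \sum_(sigma : 'S_n | unshuffle i sigma) inv_prod kappa a sigma *:
     F (take i (codom (a \o sigma))) (drop i (codom (a \o sigma))) =
  sh (codom a) (fun A B => if size A == i then F A B else 0).
Proof.
elim: n a i F => [|n IH] a i F.
  rewrite leqn0 => /eqP ->.
  have -> : codom a = [::] by apply: size0nil; rewrite size_codom_ord.
  have E (b : 'I_0 -> X) : codom b = [::].
    by apply: size0nil; rewrite size_codom_ord.
  rewrite (big_pred1 1%g) => [|s] /=.
    by rewrite E /inv_prod big_ord0 scale1r.
  rewrite [RHS](_ : _ = true); last by apply/eqP/permP => -[].
  by apply/forallP => -[].
move=> ile; rewrite codom_ordS big_mkcond big_lift_perm /=.
pose term (j : 'I_n.+1) (s : 'S_n) :=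
  inv_prod kappa a (lift_perm j ord0 s) *:
    F (take i (codom (a \o lift_perm j ord0 s)))
      (drop i (codom (a \o lift_perm j ord0 s))).
(* The first letter heads the back block and passes all i letters in front. *)
have block2 (j : 'I_n.+1) : j = i :> nat ->
    \sum_(s : 'S_n | unshuffle i s) term j s =
    sh (codom (a \o lift ord0)) (fun A B => (\prod_(y <- A) kappa y (a ord0)) *:
      if size A == i then F A (a ord0 :: B) else 0).
  move=> ji; have i_n : (i <= n)%N by rewrite -ji -ltnS.
  transitivity (sh (codom (a \o lift ord0)) (fun A B => if size A == i then
      (\prod_(y <- A) kappa y (a ord0)) *: F A (a ord0 :: B) else 0)).
    rewrite -IH //; apply: eq_bigr => s _; rewrite /term codom_lift_perm ji.
    set w := codom _; have sw : size w = n by rewrite size_codom_ord.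
    rewrite take_size_cat ?size_takel ?sw // drop_size_cat ?size_takel ?sw //.
    by rewrite inv_prod_lift ji scalerA mulrC.
  by apply: eq_sh => A B _; case: ifP; rewrite // scaler0.
(* The first letter heads the front block and passes nothing. *)
have block1 : (0 < i)%N -> \sum_(s : 'S_n | unshuffle i.-1 s) term ord0 s =
    sh (codom (a \o lift ord0)) (fun A B =>
      if size (a ord0 :: A) == i then F (a ord0 :: A) B else 0).
  case: i ile @term {block2} => // i' ile term _; rewrite /= -IH //.
  apply: eq_bigr => s _; rewrite /term codom_lift_perm take0 drop0 /=.
  by rewrite inv_prod_lift take0 big_nil mul1r.
transitivity (\sum_(j < n.+1) \sum_(s : 'S_n | unshuffle i (lift_perm j ord0 s))
    term j s).
  by apply: eq_bigr => j _; rewrite [RHS]big_mkcond.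
(* For i = 0 the front block is empty, and j = 0 is the head of the back block. *)
have [i0|i0] := posnP i.
  rewrite (bigD1 ord0) //= [X in _ + X]big1 ?addr0 => [|j j0]; last first.
    rewrite big_pred0 // => s; rewrite unshuffle_lift i0 andbF.
    by have -> : (j == 0 :> nat) = false by apply: negbTE.
  rewrite -(block2 ord0 (esym i0)) [X in _ = X + _]sh0 ?add0r => [|A B _].
    by apply: eq_bigl => s; rewrite unshuffle_lift i0.
  by rewrite i0.
rewrite (bigD1 ord0) //=; congr (_ + _).
  by rewrite -block1 //; apply: eq_bigl => s; rewrite unshuffle_lift eqxx i0.
have [i_n|i_n] := leqP i n.
  have ilt : (i < n.+1)%N by [].
  rewrite (bigD1 (Ordinal ilt)) /=; last by rewrite -val_eqE /= -lt0n.
  rewrite [X in _ + X]big1 ?addr0 => [|j /andP[/negbTE j0 ji]]; last first.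
    rewrite big_pred0 // => s; rewrite unshuffle_lift j0 /=.
    by rewrite -[X in _ == X]/(val (Ordinal ilt)) val_eqE (negbTE ji).
  rewrite -(block2 (Ordinal ilt)) //; apply: eq_bigl => s.
  by rewrite unshuffle_lift -val_eqE /= eqn0Ngt i0 eqxx.
(* Here i = n + 1: no j > 0 qualifies, and no splitting of the tail has i letters in front. *)
rewrite big1 => [|j /negbTE j0]; last first.
  rewrite big_pred0 // => s; rewrite unshuffle_lift j0 /=.
  by rewrite ltn_eqF // (leq_ltn_trans _ i_n) // -ltnS.
rewrite sh0 // => A B /perm_size; rewrite size_cat size_codom_ord => sAB.
by rewrite ltn_eqF ?scaler0 // (leq_ltn_trans _ i_n) // -sAB leq_addr.
Qed.

End Shuffles.

(** * Parity signs and decalage *)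

Section GradedSigns.
Context (K : fieldType) (X : eqType) (p : X -> bool).
Implicit Types (A B C w : seq X) (x y : X).

Definition koszul_sign y x : K := (-1) ^+ (p y && p x).
(* This is - (-1)^((p y + 1) (p x + 1)), the sign of exchanging y and x in the
   skew-symmetric convention after shifting both degrees by one. *)
Definition esign y x : K := (-1) ^+ (p y || p x).

Definition total_parity w := \big[addb/false]_(x <- w) p x.

Lemma par_cons x w : total_parity (x :: w) = p x (+) total_parity w.
Proof. exact: big_cons. Qed.

Lemma par_cat A B : total_parity (A ++ B) = total_parity A (+) total_parity B.
Proof. exact: big_cat. Qed.

Lemma prod_gsign A x : \prod_(y <- A) koszul_sign y x = (-1) ^+ (total_parity A && p x).
Proof.
elim: A => [|y A IH]; first by rewrite /total_parity !big_nil expr0.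
rewrite big_cons IH par_cons -signr_addb; congr (_ ^+ _).
by case: (p y) (total_parity A) (p x) => -[] [].
Qed.

Lemma prod_esign A x :
  \prod_(y <- A) esign y x =
  (-1) ^+ (total_parity A (+) (odd (size A) && p x) (+) (total_parity A && p x)).
Proof.
elim: A => [|y A IH]; first by rewrite /total_parity !big_nil expr0.
rewrite big_cons IH par_cons -signr_addb; congr (_ ^+ _).
by rewrite /=; case: (p y) (total_parity A) (p x) (odd _) => -[] [] [].
Qed.

(** Graded cocommutativity: the two summands of the recursion trade places, and the exchange sign
    absorbs the cost of the head letter. *)
Lemma sh_comm (M : lmodType K) w (F : seq X -> seq X -> M) :
  sh koszul_sign w F = sh koszul_sign w (fun A B =>
    (-1) ^+ (total_parity A && total_parity B) *: F B A).
Proof.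
elim: w F => [|x w IH] F /=; first by rewrite /total_parity !big_nil scale1r.
rewrite addrC; congr (_ + _); rewrite IH; apply: eq_sh => A B _.
  rewrite prod_gsign scalerA -signr_addb par_cons; congr (_ ^+ _ *: _).
  by case: (p x) (total_parity A) (total_parity B) => -[] [].
rewrite prod_gsign scalerA -signr_addb par_cons; congr (_ ^+ _ *: _).
by case: (p x) (total_parity A) (total_parity B) => -[] [].
Qed.

(* The sign of (s^-1)^{\otimes k} applied to the word w of length k is
   (-1)^(tau w). *)
Fixpoint tau w : bool :=
  if w is x :: w' then (p x && odd (size w')) (+) tau w' else false.

Lemma tau_cat A C :
  tau (A ++ C) = (total_parity A && odd (size C)) (+) tau A (+) tau C.
Proof.
elim: A => [|x A IH] /=; first by rewrite /total_parity big_nil.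
rewrite IH par_cons size_cat oddD.
by case: (p x) (total_parity A) (odd _) (odd _) (tau A) (tau C) => -[] [] [] [] [].
Qed.

Lemma tau_insert A x B :
  tau (A ++ x :: B) = total_parity A (+) (p x && odd (size B)) (+) tau (A ++ B).
Proof.
rewrite !tau_cat /=.
by case: (p x) (total_parity A) (odd _) (tau A) (tau B) => -[] [] [] [].
Qed.

(** Moving x past A changes [tau] by the parity of A plus |A| times that of x, which is the quotient
    of the [esign] cost by the Koszul cost. *)
Lemma decalage_sh (M : lmodType K) w (F : seq X -> seq X -> M) :
  sh koszul_sign w (fun A B => (-1) ^+ tau (A ++ B) *: F A B) =
  (-1) ^+ tau w *: sh esign w F.
Proof.
elim: w F => [|x w IH] F /=; first by rewrite !scale1r.
rewrite signr_addb -scalerA scalerDr -!IH scalerDr; congr (_ + _).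
  rewrite -shZ; apply: eq_sh => A B /perm_size <-.
  by rewrite scalerA -signr_addb.
rewrite -shZ; apply: eq_sh => A B /perm_size <-.
rewrite prod_gsign prod_esign !scalerA -!signr_addb; congr (_ ^+ _ *: _).
rewrite tau_insert size_cat oddD.
by case: (p x) (total_parity A) (odd _) (odd _) (tau _) => -[] [] [] [].
Qed.

(** The same comparison for a single permutation, built up by inserting first letters. *)
Lemma decalage_perm n (a : 'I_n -> X) (sigma : 'S_n) :
  inv_prod koszul_sign a sigma * (-1) ^+ tau (codom (a \o sigma)) =
  (-1) ^+ tau (codom a) * inv_prod esign a sigma.
Proof.
elim: n a sigma => [|n IH] a sigma.
  have E (b : 'I_0 -> X) : codom b = [::].
    by apply: size0nil; rewrite size_codom_ord.
  by rewrite !E /inv_prod !big_ord0.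
have [j [s ->]] := lift_permP sigma.
rewrite !inv_prod_lift codom_lift_perm tau_insert codom_ordS /=.
set w := codom (_ \o s); set A := take j w; have IHs := IH (a \o lift ord0) s.
rewrite cat_take_drop prod_gsign prod_esign.
rewrite !signr_addb [RHS]mulrACA mulrACA -!signr_addb.
have -> : inv_prod koszul_sign (a \o lift ord0) s =
  (-1) ^+ tau w * ((-1) ^+ tau (codom (a \o lift ord0)) *
  inv_prod esign (a \o lift ord0) s).
  by rewrite -IHs mulrCA -expr2 sqrr_sign mulr1.
rewrite !mulrA [LHS]mulrAC -!signr_addb; congr (_ ^+ _ * _).
have sw : size (codom (a \o lift ord0)) = (size A + size (drop j w))%N.
  by rewrite -size_cat cat_take_drop !size_codom_ord.
rewrite sw oddD.
by case: (p _) (total_parity A) (odd _) (odd _) (tau _) (tau _) => -[] [] [] [] [].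
Qed.

Lemma inv_prod_sign n (a : 'I_n -> X) (sigma : 'S_n) :
  inv_prod (fun _ _ => -1) a sigma = (-1) ^+ sigma :> K.
Proof.
elim: n a sigma => [|n IH] a sigma.
  have -> : sigma = 1%g by apply/permP => -[].
  by rewrite inv_prod1 odd_perm1.
have [j [s ->]] := lift_permP sigma.
rewrite inv_prod_lift IH odd_lift_perm addbF signr_addb signr_odd; congr (_ * _).
rewrite big_const_seq count_predT iter_mulr_1 size_takel //.
by rewrite size_codom_ord -ltnS.
Qed.

End GradedSigns.

Lemma iter_lin (K : fieldType) (M : lmodType K) (T : M -> M) n :
  linear T -> linear (iter n T).
Proof. by move=> linT; elim: n => // n IH c x y /=; rewrite IH linT. Qed.

(** * Graded vector spaces and maps out of SV *)

Definition oddz (d : int) : bool := odd `|d|%N.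

Lemma oddzD d e : oddz (d + e) = oddz d (+) oddz e.
Proof. rewrite /oddz; lia. Qed.

Lemma oddzM d e : oddz (d * e) = oddz d && oddz e.
Proof. by rewrite /oddz abszM oddM. Qed.

Lemma exprz_sign (K : fieldType) (d : int) : (-1) ^ d = (-1) ^+ oddz d :> K.
Proof.
rewrite /oddz; case: d => n; first by rewrite signr_odd.
by rewrite NegzE abszN absz_nat signr_odd -exprnN -exprVn invrN1.
Qed.

Section GradedSpaces.
Context (K : fieldType) (V : gradedSpace K).

Lemma homog_gcomp d (v : V) : homog d (gcomp V d v).
Proof. by rewrite /homog gcomp_ortho eqxx. Qed.

Lemma homog0 d : homog d (0 : V).
Proof. exact: linear0. Qed.

Lemma homogZ d c (v : V) : homog d v -> homog d (c *: v).
Proof. by rewrite /homog linearZ => ->. Qed.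

Lemma homog_ind (Q : V -> Prop) :
  (forall u v, Q u -> Q v -> Q (u + v)) -> (forall d v, homog d v -> Q v) ->
  forall v, Q v.
Proof.
move=> QD Qh v; rewrite -(gcomp_sum v); apply: big_ind => //.
  exact/(Qh 0)/homog0.
by move=> d _; apply/(Qh d)/homog_gcomp.
Qed.

Definition homog_word (w : seq V) := forall v, v \in w -> exists d, homog d v.

(** Letters are split into homogeneous components from left to right, keeping aside a prefix that is
    already homogeneous. *)
Lemma homog_word_ind (Q : seq V -> Prop) :
  (forall A c u v B, Q (A ++ u :: B) -> Q (A ++ v :: B) ->
     Q (A ++ (c *: u + v) :: B)) ->
  (forall w, homog_word w -> Q w) -> forall w, Q w.
Proof.
move=> Qlin Qh w; suff: forall B A, homog_word A -> Q (A ++ B).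
  by move=> H; apply: (H w [::]).
elim=> [|v B IH] A hA; first by rewrite cats0; exact: Qh.
elim/homog_ind: v => [u v Qu Qv|d v hv]; first by rewrite -[u]scale1r; apply: Qlin.
rewrite -cat_rcons; apply: IH => u; rewrite mem_rcons in_cons.
case/orP=> [/eqP ->|uA]; first by exists d.
exact: hA.
Qed.

Lemma gcomp_sum_fset (v : V) (D : {fset int}) (c : int -> K) :
  (forall d, d \notin D -> gcomp V d v = 0) ->
  \sum_(d \in [set: int]) c d *: gcomp V d v = \sum_(d <- D) c d *: gcomp V d v.
Proof. by move=> D0; apply: fsbigTE => d /D0 ->; rewrite scaler0. Qed.

Lemma gcomp_supp (v : V) :
  exists D : {fset int}, forall d, d \notin D -> gcomp V d v = 0.
Proof.
exists (fset_set [set d | gcomp V d v != 0]) => d.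
rewrite in_fset_set; last exact: gcomp_fin.
by move=> /negP; rewrite inE => /negP; rewrite negbK => /eqP.
Qed.

Lemma parity_linear : linear (@parity K V).
Proof.
move=> c u v; have [D Du] := gcomp_supp u; have [E Ev] := gcomp_supp v.
pose W := (D `|` E)%fset.
rewrite /parity !(@gcomp_sum_fset _ W) => [|d|d|d].
- rewrite scaler_sumr -big_split; apply: eq_bigr => d _ /=.
  by rewrite linearP scalerDr !scalerA mulrC.
- by rewrite in_fsetU negb_or => /andP[_ /Ev].
- by rewrite in_fsetU negb_or => /andP[/Du].
- by rewrite in_fsetU negb_or linearP => /andP[/Du -> /Ev ->]; rewrite scaler0 addr0.
Qed.

Lemma parity_homog d (v : V) : homog d v -> parity v = (-1) ^+ oddz d *: v.
Proof.
move=> hv; rewrite /parity (@gcomp_sum_fset _ [fset d]%fset) => [|e].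
  by rewrite big_seq_fset1 hv exprz_sign.
by rewrite in_fset1 -hv gcomp_ortho => /negbTE ->.
Qed.

Lemma parityK (v : V) : parity (parity v) = v.
Proof.
elim/homog_ind: v => [u v IHu IHv|d v hv].
  by rewrite !(lin_D parity_linear) IHu IHv.
rewrite (parity_homog hv) (lin_Z parity_linear) (parity_homog hv).
by rewrite scalerA -expr2 sqrr_sign scale1r.
Qed.

Lemma iter_parity_homog n d (v : V) :
  homog d v -> iter n (@parity K V) v = (-1) ^+ (odd n && oddz d) *: v.
Proof.
move=> hv; elim: n => [|n IH] /=; first by rewrite scale1r.
rewrite IH (lin_Z parity_linear) (parity_homog hv) scalerA -signr_addb.
by congr (_ ^+ _ *: _); case: (odd n) (oddz d) => -[].
Qed.

(** The projection onto the part of parity b, because [parity] acts as (-1)^d in degree d; 2 is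
    invertible in characteristic zero. *)
Definition parity_comp (b : bool) (v : V) : V :=
  2^-1 *: (v + (-1) ^+ b *: parity v).

Lemma parity_comp_linear b : linear (parity_comp b).
Proof.
move=> c u v; rewrite /parity_comp parity_linear !scalerDr !scalerA.
rewrite addrACA; congr (_ *: _ + _ + (_ *: _ + _)); first exact: mulrC.
by rewrite mulrC mulrA.
Qed.

Lemma parity_comp_homog (charK0 : [pchar K] =i pred0) b d (v : V) :
  homog d v -> parity_comp b v = if b == oddz d then v else 0.
Proof.
move=> hv; rewrite /parity_comp (parity_homog hv) scalerA -signr_addb.
have two : 2 != 0 :> K by have := charK0 2; rewrite !inE /= => /negbT.
have [->|ne] := eqVneq b; first by rewrite addbb scale1r -mulr2n -scaler_nat scalerK.
have -> : b = ~~ oddz d by case: b (oddz d) ne => -[].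
by rewrite addNb addbb scaleN1r subrr scaler0.
Qed.

End GradedSpaces.

(** * The universal property of SV *)

Lemma mulA5 (R : pzSemiRingType) (a x y z b : R) :
  a * (x * y * z) * b = a * x * y * (z * b).
Proof. by rewrite !mulrA. Qed.

Section SymmetricAlgebraMaps.
Context (K : fieldType) (V : gradedSpace K).
Local Notation KV := {malg K[{fmonom V}]}.
Local Notation word w := (<< FMonom (w : seq V) >> : KV).

Lemma word_cat (A B : seq V) : word (A ++ B) = word A * word B.
Proof.
rewrite (malgMEw msuppU_le msuppU_le) !big_seq_fset1 !mcoeffUU mulr1.
by congr (<< _ >>); rewrite -[RHS]/(fmmul _ _) fmmulE.
Qed.

Lemma malg_word_ind (P : KV -> Prop) :
  (forall c x y, P x -> P y -> P (c *: x + y)) ->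
  (forall w : seq V, P (word w)) -> forall x, P x.
Proof.
move=> Plin Pw x; have P0 : P 0.
  by have := Plin (-1) _ _ (Pw [::]) (Pw [::]); rewrite scaleN1r addNr.
rewrite (monalgE x); apply: big_ind => // [u v Pu Pv|k _].
  by rewrite -[u]scale1r; apply: Plin.
have -> : << x@_k *g k >> = x@_k *: << k >> :> KV.
  by apply/malgP => m; rewrite mcoeffZ mcoeffU mcoeffU mulr_natr.
by rewrite -[_ *: _]addr0; apply: Plin => //; rewrite -(fmK k); apply: Pw.
Qed.

(* {malg K[_]} is only an lalgType over a noncommutative monoid. *)
Lemma malg_scaleAr (c : K) (x y : KV) : x * (c *: y) = c *: (x * y).
Proof.
rewrite (malgMEw (fsubset_refl _) (msuppZ_le _ _)) malgME scaler_sumr.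
apply: eq_bigr => k1 _; rewrite scaler_sumr; apply: eq_bigr => k2 _.
by apply/malgP => k; rewrite mcoeffZ mcoeffU mcoeffZ mcoeffU mulrCA mulrnAr.
Qed.

Section LinearExtension.
Context (M : lmodType K) (F : seq V -> M).

Definition word_ext (x : KV) : M := \sum_(k <- msupp x) x@_k *: F k.

Lemma word_extEw (d : {fset {fmonom V}}) x : (msupp x `<=` d)%fset ->
  word_ext x = \sum_(k <- d) x@_k *: F k.
Proof.
move=> le; rewrite /word_ext (big_fset_incl _ le) => //= k kd /mcoeff_outdom ->.
exact: scale0r.
Qed.

Lemma word_ext_linear : linear word_ext.
Proof.
move=> c x y; pose d := (msupp x `|` msupp y `|` msupp (c *: x + y))%fset.
rewrite !(@word_extEw d) ?fsubsetUr //; last 2 first.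
- by apply: fsubset_trans (fsubsetUl _ _); exact: fsubsetUr.
- by apply: fsubset_trans (fsubsetUl _ _); exact: fsubsetUl.
rewrite scaler_sumr -big_split; apply: eq_bigr => k _ /=.
by rewrite mcoeffD mcoeffZ scalerDl scalerA.
Qed.

Lemma word_ext_word (w : seq V) : word_ext (word w) = F w.
Proof.
by rewrite (word_extEw msuppU_le) big_seq_fset1 mcoeffUU scale1r.
Qed.

End LinearExtension.

Definition mlin (M : lmodType K) (F : seq V -> M) := forall A c u v B,
  F (A ++ (c *: u + v) :: B) = c *: F (A ++ u :: B) + F (A ++ v :: B).

(** Adjacent exchanges suffice, as they generate the commutativity relations. The surrounding
    letters are taken homogeneous; multilinearity covers the rest. *)
Definition graded_sym (M : lmodType K) (F : seq V -> M) := forall A d e u v B,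
  homog_word A -> homog_word B -> homog d u -> homog e v ->
  F (A ++ u :: v :: B) = (-1) ^+ (oddz d && oddz e) *: F (A ++ v :: u :: B).

Lemma mlin_eq (M : lmodType K) (F G : seq V -> M) : mlin F -> mlin G ->
  (forall w, homog_word w -> F w = G w) -> F =1 G.
Proof.
move=> linF linG FG; elim/homog_word_ind => // A c u v B Fu Fv.
by rewrite linF linG Fu Fv.
Qed.

Lemma SVpi_word (w : seq V) : SVpi (word w) = \prod_(v <- w) iota v.
Proof.
elim: w => [|v w IH].
  by rewrite big_nil -[RHS]/(SVpi 1); congr SVpi; rewrite -fmoneE.
by rewrite big_cons -IH -cat1s word_cat SVpiM -fmuE.
Qed.

Lemma iota_linear : linear (@Defs.iota K V).
Proof.
move=> c u v; rewrite /iota -[c *: SVpi _]SVpiZ -SVpiD; apply/SVpiP.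
exact: SVideal_lin.
Qed.

Lemma iota_comm d e (u v : V) : homog d u -> homog e v ->
  iota u * iota v = (-1) ^+ (oddz d && oddz e) *: (iota v * iota u).
Proof.
move=> hu hv; rewrite -[iota u * _]SVpiM -[iota v * _]SVpiM -[RHS]SVpiZ.
apply/SVpiP; rewrite -oddzM -exprz_sign; exact: SVideal_comm.
Qed.

Lemma SV_homog_ind (P : SV V -> Prop) :
  (forall c x y, P x -> P y -> P (c *: x + y)) ->
  (forall w, homog_word w -> P (\prod_(v <- w) iota v)) -> forall x, P x.
Proof.
move=> Plin Ph; elim/SV_ind => x; elim/malg_word_ind: x => [c x y Px Py|w].
  by rewrite SVpiD SVpiZ; apply: Plin.
rewrite SVpi_word; elim/homog_word_ind: w => // A c u v B Pu Pv.
have := Plin c _ _ Pu Pv; rewrite !big_cat !big_cons /= iota_linear !mulrDl !mulrDr.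
by rewrite -!scalerAl -!scalerAr.
Qed.

Lemma SV_linear_eq (M : lmodType K) (T U : SV V -> M) : linear T -> linear U ->
  (forall w, homog_word w ->
     T (\prod_(v <- w) iota v) = U (\prod_(v <- w) iota v)) -> T = U.
Proof.
move=> linT linU TU; apply/funext; elim/SV_homog_ind => // c x y Tx Ty.
by rewrite linT linU Tx Ty.
Qed.

(** The linear extension of F to the free algebra kills the ideal: multilinearity handles the linear
    relations, graded symmetry the commutativity ones. *)
Lemma SV_lift (M : lmodType K) (F : seq V -> M) : mlin F -> graded_sym F ->
  exists T : SV V -> M,
    linear T /\ forall w, T (\prod_(v <- w) iota v) = F w.
Proof.
move=> linF symF.
have [E linE Ew] : exists2 E : KV -> M, linear E & forall w, E (word w) = F w.
  exists (word_ext F); [exact: word_ext_linear | exact: word_ext_word].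
(* Multilinearity frees the letters around the exchanged pair from being homogeneous. *)
have Esym d e u v : homog d u -> homog e v -> forall A B,
    F (A ++ u :: v :: B) = (-1) ^+ (oddz d && oddz e) *: F (A ++ v :: u :: B).
  move=> hu hv A B.
  suff : F (A ++ u :: v :: B) - (-1) ^+ (oddz d && oddz e) *: F (A ++ v :: u :: B) = 0.
    exact: subr0_eq.
  elim/homog_word_ind: A => [A c x y A' H1 H2|A hA].
    rewrite -!catA !cat_cons !linF scalerDr opprD addrACA scalerA [_ * c]mulrC.
    by rewrite -scalerA -scalerBr -!cat_cons !catA H1 H2 scaler0 addr0.
  elim/homog_word_ind: B => [B c x y B' H1 H2|B hB]; last first.
    by rewrite (symF _ d e) // subrr.
  have linF' a b z := linF (A ++ [:: a, b & B]) c x y B'.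
  rewrite -!cat_cons !catA !linF scalerDr opprD addrACA scalerA [_ * c]mulrC.
  by rewrite -scalerA -scalerBr -!catA !cat_cons H1 H2 scaler0 addr0.
have mulPl (a b : KV) k x y : (k *: x + y) * a * b = k *: (x * a * b) + y * a * b.
  by rewrite 2!mulrDl -2!scalerAl.
have mulPr (a b : KV) k x y : a * b * (k *: x + y) = k *: (a * b * x) + a * b * y.
  by rewrite mulrDr malg_scaleAr.
pose T A B (x : KV) := E (word A * x * word B).
have linT A B : linear (T A B).
  by move=> k x y; rewrite /T mulrDr malg_scaleAr mulrDl -scalerAl linE.
have Tw A B w : T A B (word w) = F (A ++ w ++ B).
  by rewrite /T -2!word_cat -catA Ew.
(* The factors a and b on both sides make the induction pass through [SVidealM]. *)
have EI x : SVideal x -> forall a b, E (a * x * b) = 0.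
  elim/SVideal_ind=> {x} [|x y _ IHx _ IHy|x y z _ IH|c u v|d e u v hu hv] a b.
  - by rewrite mulr0 mul0r (lin_0 linE).
  - have -> : a * (x + y) * b = 1 *: (a * x * b) + a * y * b.
      by rewrite mulrDr mulrDl scale1r.
    exact: (lin_eq0 linE 1 (IHx a b) (IHy a b)).
  - have IHab := IH (a * x) (z * b); have e := congr1 E (mulA5 a x y z b).
    by rewrite e; exact: IHab.
  - elim/malg_word_ind: a => [k x y Ex Ey|A].
      rewrite mulPl; exact: (lin_eq0 linE k Ex Ey).
    elim/malg_word_ind: b => [k x y Ex Ey|B].
      rewrite mulPr; exact: (lin_eq0 linE k Ex Ey).
    rewrite -[E _]/(T A B _).
    rewrite !fmuE addrC -scaleN1r 2!linT 3!Tw /=.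
    by rewrite linF scaleN1r addNr.
  - elim/malg_word_ind: a => [k x y Ex Ey|A].
      rewrite mulPl; exact: (lin_eq0 linE k Ex Ey).
    elim/malg_word_ind: b => [k x y Ex Ey|B].
      rewrite mulPr; exact: (lin_eq0 linE k Ex Ey).
    rewrite -[E _]/(T A B _) !fmuE -2!word_cat addrC -scaleN1r linT.
    rewrite (lin_Z (linT A B)) 2!Tw exprz_sign oddzM /=.
    by rewrite scaleN1r -(Esym _ _ _ _ hu hv) addNr.
have Epi x y : SVpi x = SVpi y -> E x = E y.
  move=> /SVpiP/EI/(_ 1 1); rewrite mul1r mulr1 -scaleN1r addrC linE.
  by rewrite scaleN1r addrC => /subr0_eq.
(* The map on the quotient is E on chosen representatives; [Epi] makes the choice irrelevant. *)
have /choice[rp rpK] : forall x : SV V, exists y : KV, SVpi y = x.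
  by elim/SV_ind => x; exists x.
exists (fun x => E (rp x)); split=> [c x y|w].
  by rewrite -linE; apply: Epi; rewrite SVpiD SVpiZ !rpK.
by rewrite -Ew; apply: Epi; rewrite rpK SVpi_word.
Qed.

(** The projection onto S^1(V). It respects commutativity because both words in such a relation have
    length at least 2, where it is 0. *)
Lemma SV_proj1 : exists T : SV V -> V, linear T /\
  forall w, T (\prod_(v <- w) iota v) = if w is [:: v] then v else 0.
Proof.
apply: SV_lift => [A c u v B|A d e u v B _ _ _ _].
  case: A => [|x [|y A]] /=; rewrite ?scaler0 ?addr0 //.
  by case: B => //; rewrite scaler0 addr0.
by case: A => [|x [|y A]] /=; rewrite scaler0.
Qed.

End SymmetricAlgebraMaps.

(** * Existence of the twisted coderivations *)

Section DecoratedWords.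
Context (K : fieldType) (charK0 : [pchar K] =i pred0) (V : gradedSpace K).

(* Letters carry the parity of the degree at which they are to be read, so
   that Koszul signs make sense on words that need not be homogeneous. *)
Local Notation X := (bool * V)%type.
Local Notation gsign := (@koszul_sign K X fst).
Local Notation sh := (sh gsign).

Definition dhomog_letter (x : X) := exists d, homog d x.2 /\ x.1 = oddz d.
Definition dhomog (w : seq X) := forall x, x \in w -> dhomog_letter x.

Lemma dhomog_cons x w : dhomog (x :: w) <-> dhomog_letter x /\ dhomog w.
Proof.
split=> [h|[hx hw] y].
  by split=> [|y yw]; apply: h; rewrite in_cons ?eqxx // yw orbT.
by rewrite in_cons => /orP[/eqP ->|/hw].
Qed.

Lemma dhomog_cat A B : dhomog (A ++ B) <-> dhomog A /\ dhomog B.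
Proof.
split=> [h|[hA hB] x]; last by rewrite mem_cat => /orP[/hA|/hB].
by split=> x xw; apply: h; rewrite mem_cat xw ?orbT.
Qed.

Lemma dhomog_perm A B : perm_eq A B -> dhomog B -> dhomog A.
Proof. by move=> /perm_mem AB hB x; rewrite AB => /hB. Qed.

Lemma dhomogP (w : seq V) : homog_word w -> exists2 w', dhomog w' & map snd w' = w.
Proof.
elim: w => [|v w IH] hw; first by exists [::].
have [w' hw' <-] : exists2 w', dhomog w' & map snd w' = w.
  by apply: IH => u uw; apply: hw; rewrite in_cons uw orbT.
have [d hd] := hw v (mem_head _ _).
exists ((oddz d, v) :: w') => //; apply/dhomog_cons; split => //.
by exists d.
Qed.

Definition dmlin (M : lmodType K) (F : seq X -> M) := forall A b c u v B,
  F (A ++ (b, c *: u + v) :: B) = c *: F (A ++ (b, u) :: B) + F (A ++ (b, v) :: B).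

Definition dsym (M : lmodType K) (F : seq X -> M) := forall A x y B,
  dhomog (A ++ x :: y :: B) ->
  F (A ++ x :: y :: B) = gsign x y *: F (A ++ y :: x :: B).

(** Sums F over all ways to replace each letter by its even or its odd part, so that a function of
    decorated words becomes one of plain words. On a homogeneous word only the true decoration
    survives. *)
Fixpoint parity_ext (M : lmodType K) (F : seq X -> M) (w : seq V) : M :=
  if w is v :: w' then
    parity_ext (fun l => F ((false, parity_comp false v) :: l)) w' +
    parity_ext (fun l => F ((true, parity_comp true v) :: l)) w'
  else F [::].

Section ParityExtension.
Context (M : lmodType K).
Implicit Types F G : seq X -> M.

Lemma parity_ext_linear c F G w :
  parity_ext (fun l => c *: F l + G l) w = c *: parity_ext F w + parity_ext G w.
Proof.
by elim: w F G => [|v w IH] F G //=; rewrite !IH scalerDr addrACA.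
Qed.

Lemma parity_ext_mlin F : dmlin F -> mlin (parity_ext F).
Proof.
move=> linF A c u v B; elim: A F linF => [|z A IH] F linF /=.
  rewrite scalerDr addrACA -!parity_ext_linear !parity_comp_linear.
  by congr (parity_ext _ _ + parity_ext _ _); apply/funext => l; apply: (linF [::]).
rewrite !IH; first by rewrite scalerDr addrACA.
  by move=> C b k x y D; apply: (linF (_ :: C)).
by move=> C b k x y D; apply: (linF (_ :: C)).
Qed.

Lemma dmlin0 F b A B : dmlin F -> F (A ++ (b, 0) :: B) = 0.
Proof.
move=> linF; have := linF A b (-1) 0 0 B.
by rewrite scaler0 addr0 scaleN1r addNr.
Qed.

Lemma parity_ext_homog F w : dmlin F -> dhomog w -> parity_ext F (map snd w) = F w.
Proof.
elim: w F => [|[b v] w IH] F linF //= /dhomog_cons[[d /= [hv ->]] hw].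
rewrite !IH // ?(parity_comp_homog charK0 _ hv); last 2 first.
- by move=> A c k x y B; apply: (linF (_ :: A)).
- by move=> A c k x y B; apply: (linF (_ :: A)).
by case: (oddz d); rewrite /= (dmlin0 _ [::]) ?add0r ?addr0.
Qed.

Lemma SV_dlift F : dmlin F -> dsym F ->
  exists T : SV V -> M, linear T /\
    forall w, dhomog w -> T (\prod_(x <- w) iota x.2) = F w.
Proof.
move=> linF symF; have linE := parity_ext_mlin linF.
have [|T [linT Tw]] := SV_lift linE.
  move=> _ d e u v _ /dhomogP[A hA <-] /dhomogP[B hB <-] hu hv.
  have hh a b : dhomog_letter a -> dhomog_letter b -> dhomog (A ++ a :: b :: B).
    move=> ha hb; apply/dhomog_cat; split=> //; apply/dhomog_cons; split=> //.
    by apply/dhomog_cons.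
  have hu' : dhomog_letter (oddz d, u) by exists d.
  have hv' : dhomog_letter (oddz e, v) by exists e.
  have := symF A (oddz d, u) (oddz e, v) B (hh _ _ hu' hv').
  rewrite -(parity_ext_homog linF (hh _ _ hu' hv')).
  by rewrite -(parity_ext_homog linF (hh _ _ hv' hu')) !map_cat.
exists T; split=> // w hw; rewrite -(parity_ext_homog linF hw) -Tw.
by rewrite big_map.
Qed.

End ParityExtension.

Section ShuffleExtension.
Context (M : lmodType K).
Implicit Types Phi : seq X -> seq X -> M.

(** The signs of [sh] see only the decorations, which the three words in the linearity relation
    share. *)
Lemma sh_dmlin Phi : (forall B, dmlin (Phi ^~ B)) -> (forall A, dmlin (Phi A)) ->
  dmlin (fun w => sh w Phi).
Proof.
move=> lin1 lin2 A b c u v B; elim: A Phi lin1 lin2 => [|x A IH] Phi lin1 lin2 /=.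
  rewrite scalerDr addrACA -!sh_linear; congr (_ + _); apply: eq_sh => C D _.
    exact: (lin1 D [::]).
  by rewrite !prod_gsign (lin2 C [::]) scalerDr !scalerA mulrC.
rewrite (IH (fun A B => Phi (x :: A) B)) => [|D|C]; last 2 first.
- by move=> C k d y z E; apply: (lin1 D (_ :: C)).
- by move=> D k d y z E; apply: lin2.
rewrite (IH (fun A B => _ *: Phi A (x :: B))) => [|D|C]; last 2 first.
- move=> C k d y z E; rewrite lin1 scalerDr !scalerA !prod_gsign.
  by rewrite !par_cat !par_cons /= [_ * d]mulrC.
- move=> D k d y z E; rewrite (lin2 C (_ :: D)) scalerDr !scalerA.
  by rewrite [_ * d]mulrC.
by rewrite scalerDr addrACA.
Qed.

(** If the two letters land in the same factor, the symmetry of [Phi] there applies; if they are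
    separated, the exchange swaps two of the four summands. *)
Lemma sh_dsym Phi : (forall B, dsym (Phi ^~ B)) -> (forall A, dsym (Phi A)) ->
  dsym (fun w => sh w Phi).
Proof.
move=> sym1 sym2 A x y B; elim: A Phi sym1 sym2 => [|z A IH] Phi sym1 sym2.
  move=> /dhomog_cons[hx /dhomog_cons[hy hB]] /=.
  have gsignC : gsign y x = gsign x y by rewrite /koszul_sign andbC.
  have gsignK : gsign x y * gsign x y = 1 by rewrite -expr2 sqrr_sign.
  have hxy C D : perm_eq (C ++ D) B -> dhomog (x :: y :: C) /\ dhomog (x :: y :: D).
    move=> CD; have /dhomog_cat[hC hD] := dhomog_perm CD hB.
    by split; apply/dhomog_cons; split=> //; apply/dhomog_cons.
  rewrite !scalerDr -!shZ addrACA; congr (_ + _ + (_ + _)); apply: eq_sh => C D CD.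
  - exact/(sym1 D [::])/(hxy _ _ CD).1.
  - by rewrite big_cons gsignC scalerA.
  - by rewrite big_cons scalerA mulrA gsignK mul1r.
  - rewrite (sym2 C [::]); last exact: (hxy _ _ CD).2.
    by rewrite !scalerA [in LHS]mulrC mulrA [in RHS]mulrAC.
move=> /dhomog_cons[hz hAB] /=.
rewrite (IH (fun A B => Phi (z :: A) B)) => [|D C a b E h|D|//]; last 2 first.
- by apply: (sym1 _ (_ :: _)); apply/dhomog_cons.
- exact: sym2.
rewrite (IH (fun A B => _ *: Phi A (z :: B))) =>
  [|D C a b E h|D C a b E h|//]; last 2 first.
- rewrite sym1 // !scalerA mulrC !prod_gsign !par_cat !par_cons.
  by rewrite (addbCA a.1).
- rewrite (sym2 _ (_ :: _)); last exact/dhomog_cons.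
  by rewrite !scalerA mulrC.
by rewrite scalerDr.
Qed.

End ShuffleExtension.
End DecoratedWords.

(** * From multilinear maps to functions of words *)

Section AdjacentSwap.
Context (R : comPzRingType) (X : Type) (kappa : X -> X -> R).

Lemma adjacent_swap A x y B n (a : 'I_n -> X) : codom a = A ++ x :: y :: B ->
  exists2 sigma : 'S_n, codom (a \o sigma) = A ++ y :: x :: B &
    inv_prod kappa a sigma = kappa y x.
Proof.
elim: A n a => [|z A IH] [|n] a e.
- by have := congr1 size e; rewrite size_codom_ord.
- move: e; rewrite codom_ordS /= => -[ax ea].
  case: n a ax ea => [|n] a ax ea.
    by have := congr1 size ea; rewrite size_codom_ord.
  have a1 : codom (a \o lift ord0 \o (1%g : 'S_n.+1)) = y :: B.
    by rewrite -ea; apply: eq_codom => i; rewrite /= perm1.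
  (* [lift ord0 ord0] is position 1: the first letter is put right after the second. *)
  exists (lift_perm (lift ord0 ord0) ord0 1%g).
    by rewrite codom_lift_perm a1 ax /= take0 drop0.
  by rewrite inv_prod_lift a1 inv_prod1 /= take0 big_seq1 mulr1 ax.
- by have := congr1 size e; rewrite size_codom_ord.
- move: e; rewrite codom_ordS /= => -[az /IH[sigma es ek]].
  exists (lift_perm ord0 ord0 sigma).
    by rewrite codom_lift_perm take0 drop0 es az.
  by rewrite inv_prod_lift take0 big_nil mul1r.
Qed.

End AdjacentSwap.

Lemma prod_drop_codom (R : pzSemiRingType) X k (f : 'I_k -> X) n (G : X -> R) :
  \prod_(x <- drop n (codom f)) G x = \prod_(i < k | (n <= i)%N) G (f i).
Proof.
elim: k f n => [|k IH] f n.
  by rewrite big_ord0 codomE (size0nil (size_enum_ord 0)) big_nil.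
rewrite codom_ordS [RHS]big_mkcond big_ord_recl /=; case: n => [|n] /=.
  rewrite big_cons; congr (_ * _); rewrite -[codom _]drop0 IH [LHS]big_mkcond.
  by apply: eq_bigr.
by rewrite mul1r IH [LHS]big_mkcond.
Qed.

Section Words.
Context (K : fieldType) (V : gradedSpace K).
Local Notation X := (bool * V)%type.

Lemma args_codom k (b : 'I_k -> V) : args (codom b) k = b.
Proof. by apply/funext => i; rewrite /args nth_codom_ord. Qed.

Lemma args_take (w : seq V) n : args (take n w) n = args w n.
Proof. by apply/funext => i; rewrite /args nth_take. Qed.

Lemma map_codom (U W : Type) k (f : U -> W) (b : 'I_k -> U) :
  map f (codom b) = codom (f \o b).
Proof. by rewrite !codomE -map_comp. Qed.

Lemma dhomog_codom (w : seq X) : dhomog w ->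
  exists (a : 'I_(size w) -> X) (d : 'I_(size w) -> int),
    [/\ codom a = w, homogs d (snd \o a) & forall i, (a i).1 = oddz (d i)].
Proof.
move=> hw; pose a (i : 'I_(size w)) := nth (false, 0) w i.
have /choice[d hd] (i : 'I_(size w)) : exists d, homog d (a i).2 /\ (a i).1 = oddz d.
  by apply/hw/mem_nth.
by exists a, d; split=> [|i|i]; [exact: ord_codom | case: (hd i) | case: (hd i)].
Qed.

Lemma codom_dhomog n (d : 'I_n -> int) (v : 'I_n -> V) : homogs d v ->
  dhomog (codom (fun i => (oddz (d i), v i))).
Proof.
move=> hv _ /codomP[i ->]; exists (d i); split=> //; exact: hv.
Qed.

Lemma koszul_inv_prod n (a : 'I_n -> X) (d : 'I_n -> int) sigma :
  (forall i, (a i).1 = oddz (d i)) ->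
  koszul K d sigma = inv_prod (koszul_sign K fst) a sigma.
Proof.
move=> ad; apply: eq_bigr => i _; apply: eq_bigr => j _.
by rewrite exprz_sign oddzM /koszul_sign !ad.
Qed.

Lemma skoszul_inv_prod n (a : 'I_n -> X) (d : 'I_n -> int) sigma :
  (forall i, (a i).1 = ~~ oddz (d i)) ->
  skoszul K d sigma = inv_prod (esign K fst) a sigma.
Proof.
move=> ad; rewrite /skoszul -(inv_prod_sign K a) /koszul /inv_prod -big_split.
apply: eq_bigr => i _; rewrite -big_split; apply: eq_bigr => j _.
by rewrite exprz_sign oddzM /esign !ad -negb_and signrN /= mulN1r.
Qed.

(** Extension by 0 to other lengths lets a sum over all splittings select those with n letters in
    front. *)
Definition word_fun n (f : multimap V n) (w : seq V) : V :=
  if size w == n then f (args w n) else 0.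

Lemma word_fun_codom n (f : multimap V n) (b : 'I_n -> V) :
  word_fun f (codom b) = f b.
Proof. by rewrite /word_fun size_codom_ord eqxx args_codom. Qed.

Lemma word_fun_mlin n (f : multimap V n) : multilinear f -> mlin (word_fun f).
Proof.
move=> linf A c u v B; rewrite /word_fun !size_cat /=.
case: eqP => [sn|_]; last by rewrite scaler0 addr0.
have An : (size A < n)%N by rewrite -sn addnS leq_addr.
have E z : args (A ++ z :: B) n = [eta args (A ++ 0 :: B) n with Ordinal An |-> z].
  apply/funext => i; rewrite /args /= -val_eqE /= !nth_cat.
  case: ltngtP => // [iA|->]; last by rewrite subnn.
  by rewrite -(subnSK iA).
by rewrite E linf -!E.
Qed.

Lemma word_fun_sym n (f : multimap V n) A x y B : symmetric_map f ->
  dhomog (A ++ x :: y :: B) ->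
  word_fun f (map snd (A ++ x :: y :: B)) =
  koszul_sign K fst x y *: word_fun f (map snd (A ++ y :: x :: B)).
Proof.
move=> symf /dhomog_codom; set w := A ++ _ => -[a [d [aw ha ad]]].
have sw : size (A ++ y :: x :: B) = size w by rewrite /w !size_cat.
have [sn|sn] := eqVneq (size w) n; last first.
  by rewrite /word_fun !size_map sw (negbTE sn) scaler0.
case: n / sn f symf => f symf.
have [sigma as_ ks] := adjacent_swap (koszul_sign K fst) aw.
have -> : map snd w = codom (snd \o a) by rewrite -map_codom aw.
rewrite -as_ map_codom !word_fun_codom.
rewrite -[snd \o (a \o sigma)]/((snd \o a) \o sigma) (symf _ _ _ ha).
rewrite (koszul_inv_prod _ ad) ks scalerA {1}/koszul_sign andbC -expr2 sqrr_sign.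
by rewrite scale1r.
Qed.

End Words.

Lemma mul_swap (K : fieldType) (A : algType K) (c : K) (p u v q : A) :
  u * v = c *: (v * u) -> p * (u * (v * q)) = c *: (p * (v * (u * q))).
Proof. by move=> uv; rewrite !mulrA -(mulrA p u v) uv -scalerAr -scalerAl !mulrA. Qed.

Lemma mul_linear_mid (K : fieldType) (A : algType K) (c : K) (p u v q : A) :
  p * ((c *: u + v) * q) = c *: (p * (u * q)) + p * (v * q).
Proof. by rewrite mulrDl mulrDr -scalerAl -scalerAr. Qed.

Lemma prod_codom (R : pzSemiRingType) X k (f : 'I_k -> X) (G : X -> R) :
  \prod_(x <- codom f) G x = \prod_(i < k) G (f i).
Proof. by rewrite codomE big_map enumT. Qed.

(** * The twisted coderivation of one operation *)

Section TildeExtension.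
Context (K : fieldType) (charK0 : [pchar K] =i pred0) (V : gradedSpace K).
Context (al : V -> V) (linal : linear al).
Hypothesis al_deg0 : forall d v, homog d v -> homog d (al v).
Local Notation X := (bool * V)%type.
Local Notation gsign := (@koszul_sign K X fst).
Local Notation sh := (sh gsign).
Local Notation par := (@total_parity X fst).

Lemma iter_homog n d v : homog d v -> homog d (iter n al v).
Proof. by elim: n => //= n IH /IH; apply: al_deg0. Qed.

Definition dalpha n (x : X) : X := (x.1, iter n al x.2).

Lemma dalpha_homog n x : dhomog_letter x -> dhomog_letter (dalpha n x).
Proof. by move=> [d [hx x1]]; exists d; split=> //; apply: iter_homog. Qed.

Lemma map_dalpha_homog n w : dhomog w -> dhomog (map (dalpha n) w).
Proof. by move=> hw _ /mapP[x xw ->]; apply/dalpha_homog/hw. Qed.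

Lemma map_snd_dalpha n w : map snd (map (dalpha n) w) = map (iter n al) (map snd w).
Proof. by rewrite -!map_comp. Qed.

Definition alpha_prod n (B : seq X) : SV V := \prod_(x <- B) iota (iter n al x.2).

Lemma alpha_prod_cat n A B : alpha_prod n (A ++ B) = alpha_prod n A * alpha_prod n B.
Proof. exact: big_cat. Qed.

Lemma alpha_prod_cons n x B :
  alpha_prod n (x :: B) = iota (iter n al x.2) * alpha_prod n B.
Proof. exact: big_cons. Qed.

Lemma alpha_prod_dmlin n : dmlin (alpha_prod n).
Proof.
move=> A b c u v B; rewrite !alpha_prod_cat !alpha_prod_cons.
rewrite [iter n al _](iter_lin n linal) iota_linear; exact: mul_linear_mid.
Qed.

Lemma alpha_prod_dsym n : dsym (alpha_prod n).
Proof.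
move=> A x y B /dhomog_cat[_ /dhomog_cons[[d [hx xd]] /dhomog_cons[[e [hy ye]] _]]].
rewrite !alpha_prod_cat !alpha_prod_cons; apply: mul_swap.
rewrite /koszul_sign xd ye; apply: iota_comm; exact: iter_homog.
Qed.

Section OneMap.
Context (n : nat) (rho : multimap V n).
Hypothesis (linrho : multilinear rho) (symrho : symmetric_map rho).

Definition tilde_kernel (A B : seq X) : SV V :=
  iota (word_fun rho (map snd A)) * alpha_prod n.-1 B.

Lemma tilde_kernel_sum k (d : 'I_k -> int) (v : 'I_k -> V) :
  (if (k < n)%N then 0 else
    \sum_(sigma : 'S_k | unshuffle n sigma)
      koszul K d sigma *:
        (iota (rho (args (codom (v \o sigma)) n)) *
         \prod_(i < k | (n <= i)%N) iota (iter (n - 1) al (v (sigma i))))) =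
  sh (codom (fun i => (oddz (d i), v i))) tilde_kernel.
Proof.
set a := fun i : 'I_k => (oddz (d i), v i).
have ker0 A B : size A != n -> tilde_kernel A B = 0.
  move=> sA; rewrite /tilde_kernel /word_fun size_map (negbTE sA).
  by rewrite (lin_0 (@iota_linear K V)) mul0r.
case: ltnP => kn.
  rewrite sh0 // => A B /perm_size; rewrite size_cat size_codom_ord => sAB.
  by apply: ker0; rewrite ltn_eqF // (leq_ltn_trans _ kn) // -sAB leq_addr.
transitivity (sh (codom a) (fun A B => if size A == n then tilde_kernel A B else 0));
    last first.
  by apply: eq_sh => A B _; case: eqP => // /eqP /ker0.
rewrite -(@shuffle_sum K _ gsign _ _ a n tilde_kernel kn); apply: eq_bigr => sigma _.
rewrite (koszul_inv_prod (a := a) (d := d) sigma (fun=> erefl)).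
have e1 : word_fun rho (map snd (take n (codom (a \o sigma)))) =
    rho (args (codom (v \o sigma)) n).
  rewrite /word_fun map_take map_codom size_takel ?size_codom_ord // eqxx.
  by rewrite args_take.
have e2 : alpha_prod n.-1 (drop n (codom (a \o sigma))) =
    \prod_(i < k | (n <= i)%N) iota (iter (n - 1) al (v (sigma i))).
  by rewrite /alpha_prod prod_drop_codom subn1.
by rewrite /tilde_kernel e1 e2.
Qed.

Lemma tilde_specE T : tilde_spec al rho T <->
  linear T /\ forall w, dhomog w -> T (\prod_(x <- w) iota x.2) = sh w tilde_kernel.
Proof.
split=> -[linT Tw]; split; [exact: linT| |exact: linT|].
  move=> w /dhomog_codom[a [d [aw ha ad]]].
  have ea : a = fun i => (oddz (d i), (snd \o a) i).
    by apply/funext => i; rewrite -ad /=; case: (a i).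
  have := Tw _ d (snd \o a) ha; rewrite tilde_kernel_sum -ea aw => <-.
  by have := prod_codom a (fun x => iota x.2); rewrite aw => ->.
move=> k d v hv; rewrite tilde_kernel_sum -Tw; last exact: codom_dhomog.
by rewrite prod_codom.
Qed.

(** As [tilde] picks a solution whenever there is one, only existence matters. The kernel is
    multilinear and graded symmetric in each factor, hence so is its sum over unshuffles, and
    [SV_dlift] applies. *)
Lemma tildeP : tilde_spec al rho (tilde al rho).
Proof.
apply: (@xgetPex _ _ [set T | tilde_spec al rho T]).
suff [T HT] : exists T : SV V -> SV V, linear T /\ forall w, dhomog w ->
    T (\prod_(x <- w) iota x.2) = sh w tilde_kernel by exists T; apply/tilde_specE.
apply: SV_dlift => //.
  apply: sh_dmlin => [B A b c u v C|A B b c u v C].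
    rewrite /tilde_kernel !map_cat /= (word_fun_mlin linrho) iota_linear.
    by rewrite mulrDl -scalerAl.
  by rewrite /tilde_kernel alpha_prod_dmlin mulrDr -scalerAr.
apply: sh_dsym => [B A x y C h|A B x y C h]; rewrite /tilde_kernel.
  by rewrite (word_fun_sym symrho h) (lin_Z (@iota_linear K V)) scalerAl.
by rewrite (alpha_prod_dsym _ h) -scalerAr.
Qed.

End OneMap.
End TildeExtension.

(** * The square of a coderivation *)

Lemma mul_scaleA (K : fieldType) (A : algType K) (c : K) (u v q : A) :
  c *: (u * (v * q)) = (c *: (u * v)) * q.
Proof. by rewrite -scalerAl mulrA. Qed.

Lemma mulr_left_linear (K : fieldType) (A : algType K) (q : A) :
  linear (fun x : A => x * q).
Proof. by move=> c x y; rewrite mulrDl -scalerAl. Qed.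

(** The sign pattern of the cancellation in [sum_tilde_sq]: a comes from cocommutativity, e from
    exchanging the two outputs, b and c from a term and its partner. *)
Lemma scale_mul_opp (K : fieldType) (A : algType K) (a b c e : bool) (u v q : A) :
  u = (-1) ^+ e *: v -> a (+) (b (+) e) = ~~ c ->
  (-1) ^+ a *: (((-1) ^+ b *: u) * q) = (-1 : K) *: (((-1) ^+ c *: v) * q).
Proof.
move=> -> abec; rewrite -!scalerAl !scalerA -!signr_addb abec.
by rewrite signrN mulN1r.
Qed.

Lemma eq_opp_scale0 (K : fieldType) (M : lmodType K) (x : M) :
  [pchar K] =i pred0 -> x = -1 *: x -> x = 0.
Proof.
move=> charK0; rewrite scaleN1r => /eqP; rewrite -addr_eq0 -mulr2n -scaler_nat.
have /negbT two := charK0 2; rewrite scaler_eq0 => /orP[|/eqP //].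
by rewrite inE /= in two; rewrite (negbTE two).
Qed.

Section FamilyFun.
Context (K : fieldType) (V : gradedSpace K) (rho : forall n, multimap V n).
Arguments rho : clear implicits.

(** The length of the word selects the operation; the empty word gets 0 because the families start
    at n = 1. *)
Definition family_fun (w : seq V) : V :=
  if nilp w then 0 else word_fun (rho (size w)) w.

Lemma family_fun_codom n (b : 'I_n -> V) : (0 < n)%N -> family_fun (codom b) = rho n b.
Proof.
move=> n0; rewrite /family_fun /nilp size_codom_ord eqn0Ngt n0 /=.
exact: word_fun_codom.
Qed.

Lemma family_fun_args w : (0 < size w)%N ->
  family_fun w = rho (size w) (args w (size w)).
Proof. by move=> w0; rewrite /family_fun /nilp eqn0Ngt w0 /word_fun eqxx. Qed.

Hypothesis linrho : forall n, (0 < n)%N -> multilinear (rho n).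

Lemma family_fun_mlin : mlin family_fun.
Proof.
move=> A c u v B; rewrite /family_fun /nilp !size_cat /= addnS /=.
exact/word_fun_mlin/linrho.
Qed.

Lemma family_fun0 w : family_fun (0 :: w) = 0.
Proof.
have := family_fun_mlin [::] (-1) 0 0 w.
by rewrite scaler0 addr0 scaleN1r addNr.
Qed.

Lemma family_funZ c v w : family_fun (c *: v :: w) = c *: family_fun (v :: w).
Proof.
have := family_fun_mlin [::] c v 0 w.
by rewrite addr0 /= family_fun0 addr0.
Qed.

End FamilyFun.

Section Square.
Context (K : fieldType) (charK0 : [pchar K] =i pred0) (V : gradedSpace K).
Context (al : V -> V) (linal : linear al).
Hypothesis al_deg0 : forall d v, homog d v -> homog d (al v).
Local Notation X := (bool * V)%type.
Local Notation gsign := (@koszul_sign K X fst).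
Local Notation sh := (sh gsign).
Local Notation par := (@total_parity X fst).
Local Notation aprod := (alpha_prod al).
Local Notation dalpha := (dalpha al).

Lemma alpha_prod_dalpha n m B :
  aprod n (map (dalpha m) B) = aprod (n + m) B.
Proof.
by rewrite /alpha_prod big_map; apply: eq_bigr => x _; rewrite /= -iterD.
Qed.

Lemma SV_proj : exists T : SV V -> V, linear T /\
  forall v n E, T (iota v * aprod n E) = if E is [::] then v else 0.
Proof.
have [T [linT Tw]] := SV_proj1 V; exists T; split=> // v n E.
have -> : iota v * aprod n E =
    \prod_(u <- v :: map (fun x => iter n al x.2) E) iota u.
  by rewrite big_cons big_map.
by rewrite Tw; case: E.
Qed.

Lemma par_dalpha n w : par (map (dalpha n) w) = par w.
Proof. exact: big_map. Qed.

Section Family.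
Context (rho : forall n, multimap V n).
Arguments rho : clear implicits.
Hypothesis rhoP : forall n, (0 < n)%N ->
  [/\ multilinear (rho n), symmetric_map (rho n),
      has_degree (-1) (rho n) & commutes_with al (rho n)].

Local Notation R := (family_fun rho).

Let linrho n (n0 : (0 < n)%N) : multilinear (rho n).
Proof. by have [] := rhoP n0. Qed.

Lemma par_codom n (a : 'I_n -> X) (d : 'I_n -> int) :
  (forall i, (a i).1 = oddz (d i)) -> par (codom a) = oddz (\sum_i d i).
Proof.
move=> ad; rewrite /total_parity codomE big_map enumT.
by elim/big_rec2: _ => // i b1 b2 _ ->; rewrite oddzD ad.
Qed.

Lemma family_fun_homog (w : seq X) :
  dhomog w -> dhomog_letter (~~ par w, R (map snd w)).
Proof.
case: w => [|x w].
  (* The value 0 is homogeneous of every degree, so of an odd one as its decoration demands. *)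
  by move=> _; exists 1; rewrite /total_parity big_nil; split=> //; exact: homog0.
move=> /dhomog_codom[a [d [aw ha ad]]].
have e : map snd (x :: w) = codom (snd \o a) by rewrite -map_codom aw.
have pe : par (x :: w) = oddz (\sum_i d i) by rewrite -(par_codom ad) aw.
have [_ _ deg _] := rhoP (ltn0Sn (size w)).
exists (\sum_i d i - 1); rewrite pe e family_fun_codom //; split; first exact: deg.
by rewrite oddzD addbT.
Qed.

Lemma family_fun_alpha w : al (R w) = R (map al w).
Proof.
case: w => [|v w]; first exact: (lin_0 linal).
rewrite -(ord_codom v (erefl (size (v :: w)))) map_codom !family_fun_codom //.
by have [_ _ _ ->] := rhoP (ltn0Sn (size w)).
Qed.

Lemma family_fun_iter_alpha n w : iter n al (R w) = R (map (iter n al) w).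
Proof.
elim: n => [|n IH] /=; first by rewrite map_id.
by rewrite IH family_fun_alpha -map_comp.
Qed.

Lemma iota0 : iota (0 : V) = 0.
Proof. exact: (lin_0 (@iota_linear K V)). Qed.

Definition D_kernel (A B : seq X) : SV V :=
  iota (R (map snd A)) * aprod (size A).-1 B.

Lemma tilde_homog n w : (0 < n)%N -> dhomog w ->
  tilde al (rho n) (\prod_(x <- w) iota x.2) = sh w (tilde_kernel al (rho n)).
Proof.
move=> n0; have [lin sym _ _] := rhoP n0.
have /tilde_specE[_] := tildeP charK0 linal al_deg0 lin sym; exact.
Qed.

Lemma tilde_linear n : (0 < n)%N -> linear (tilde al (rho n)).
Proof.
move=> n0; have [lin sym _ _] := rhoP n0.
by have /tilde_specE[] := tildeP charK0 linal al_deg0 lin sym.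
Qed.

Lemma tilde_kernel_neq n A B : n != size A -> tilde_kernel al (rho n) A B = 0.
Proof.
move=> nA; rewrite /tilde_kernel /word_fun size_map eq_sym (negbTE nA).
by rewrite iota0 mul0r.
Qed.

Lemma tilde_homog0 n w : (size w < n)%N -> dhomog w ->
  tilde al (rho n) (\prod_(x <- w) iota x.2) = 0.
Proof.
move=> nw hw; rewrite tilde_homog ?(leq_trans _ nw) //; apply: sh0.
move=> A B /perm_size; rewrite size_cat => sAB; apply: tilde_kernel_neq.
by rewrite gtn_eqF // (leq_ltn_trans _ nw) // -sAB leq_addr.
Qed.

(** An operation with more arguments than a word has letters kills that word; this makes the sum
    over n finite. *)
Lemma tilde_vanish (x : SV V) :
  exists N, forall n, (N < n)%N -> tilde al (rho n) x = 0.
Proof.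
elim/SV_homog_ind: x => [c x y [N1 H1] [N2 H2]|_ /dhomogP[w hw <-]].
  exists (maxn N1 N2) => n; rewrite gtn_max => /andP[n1 n2].
  apply: lin_eq0; [apply: tilde_linear; exact: leq_trans n1 | exact: H1 | exact: H2].
by exists (size w) => n nw; rewrite big_map tilde_homog0.
Qed.

Lemma sum_tilde_trunc N (x : SV V) :
  (forall n, (N < n)%N -> tilde al (rho n) x = 0) ->
  sum_tilde al rho x = \sum_(1 <= n < N.+1) tilde al (rho n) x.
Proof.
move=> HN; rewrite /sum_tilde (fsbigE (index_iota 1 N.+1)); last 3 first.
- exact: iota_uniq.
- by move=> n /=; rewrite mem_index_iota => /andP[].
- move=> n /= n0; rewrite mem_index_iota n0 /= -leqNgt; exact: HN.
rewrite [LHS]big_seq_cond [RHS]big_seq_cond; apply: eq_bigl => n.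
case: (boolP (n \in index_iota _ _)) => //=; rewrite mem_index_iota => /andP[n0 _].
exact: mem_set.
Qed.

Lemma sum_tilde_linear : linear (sum_tilde al rho).
Proof.
move=> c x y; have [N1 H1] := tilde_vanish x; have [N2 H2] := tilde_vanish y.
pose N := maxn N1 N2.
have Hx n : (N < n)%N -> tilde al (rho n) x = 0.
  by rewrite gtn_max => /andP[+ _]; apply: H1.
have Hy n : (N < n)%N -> tilde al (rho n) y = 0.
  by rewrite gtn_max => /andP[_ +]; apply: H2.
rewrite (sum_tilde_trunc Hx) (sum_tilde_trunc Hy) (@sum_tilde_trunc N); last first.
  move=> n nN; apply: lin_eq0; [|exact: Hx|exact: Hy].
  by apply: tilde_linear; exact: leq_trans nN.
rewrite scaler_sumr -big_split; apply: eq_big_nat => n /andP[n0 _].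
exact: tilde_linear.
Qed.

(** For each splitting, only the operation whose arity is the length of the front factor
    contributes. *)
Lemma sum_tilde_homog w : dhomog w ->
  sum_tilde al rho (\prod_(x <- w) iota x.2) = sh w D_kernel.
Proof.
move=> hw; rewrite (@sum_tilde_trunc (size w)); last first.
  by move=> n nw; exact: tilde_homog0.
rewrite (eq_big_nat _ _ (F2 := fun n => sh w (tilde_kernel al (rho n)))); last first.
  by move=> n /andP[n0 _]; apply: tilde_homog.
rewrite -sh_sum; apply: eq_sh => A B /perm_size; rewrite size_cat => sAB.
rewrite /D_kernel /family_fun /nilp size_map; have [A0|A0] := posnP (size A).
  rewrite big_nat_cond big1 => [|n /andP[/andP[n0 _] _]].
    by rewrite iota0 mul0r.
  by apply: tilde_kernel_neq; rewrite A0 -lt0n.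
rewrite (bigD1_seq (size A)) ?iota_uniq //=; last first.
  by rewrite mem_index_iota A0 ltnS -sAB leq_addr.
by rewrite big1 ?addr0 // => n nA; apply: tilde_kernel_neq.
Qed.

(* The component of D \o D landing in S^1(V). *)
Definition jacobiator (w : seq X) : V :=
  sh w (fun A C => R (R (map snd A) :: map (iter (size A).-1 al) (map snd C))).

Lemma sum_tilde_sq w : dhomog w ->
  sum_tilde al rho (sum_tilde al rho (\prod_(x <- w) iota x.2)) =
  sh w (fun Y E => iota (jacobiator Y) * aprod (size Y).-1 E).
Proof.
move=> hw; rewrite sum_tilde_homog // (sh_comp _ _ _ sum_tilde_linear).
pose Th (A C E : seq X) : SV V :=
  iota (R (R (map snd A) :: map (iter (size A).-1 al) (map snd C)))
  * aprod (size A + size C).-1 E.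
pose U (A C : seq X) : SV V := iota (R (map (iter (size A).-1 al) (map snd C))).
(* [Ps] collects the terms where the outer operation misses the inner one; they
   cancel in pairs. *)
pose Ps (A C E : seq X) : SV V := ((-1) ^+ (par C && ~~ par A) *: (U A C * U C A)) *
  aprod ((size C).-1 + (size A).-1) E.
have step A B : perm_eq (A ++ B) w -> sum_tilde al rho (D_kernel A B) =
    sh B (Th A) + sh B (Ps A).
  move=> AB; have /dhomog_cat[hA hB] := dhomog_perm AB hw.
  pose r : X := (~~ par A, R (map snd A)); pose m := (size A).-1.
  have -> : D_kernel A B = \prod_(x <- r :: map (dalpha m) B) iota x.2.
    by rewrite big_cons big_map.
  rewrite sum_tilde_homog; last first.
    apply/dhomog_cons; split; [exact: family_fun_homog | exact: map_dalpha_homog].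
  have kf x y : gsign (dalpha m y) (dalpha m x) = gsign y x by [].
  (* One unfolding of [sh] at the head letter r separates the terms where the outer operation takes
     r ([Th]) from those where it does not ([Ps]). *)
  rewrite [LHS]/= 2!(sh_map _ _ kf); apply: congr2; apply: eq_sh => C E _.
    rewrite /D_kernel /= map_snd_dalpha size_map alpha_prod_dalpha /Th -/m.
    (* The twist exponents |C| + (|A| - 1) and |A| + |C| - 1 agree for nonempty A; for empty A, r is
       0 and both sides vanish. *)
    case: A @r @m {AB hA kf} => [|a A] r m.
      by rewrite /r /= (family_fun0 linrho) iota0 !mul0r.
    by rewrite /m /= addnC.
  rewrite prod_gsign par_dalpha /D_kernel map_snd_dalpha size_map.
  rewrite alpha_prod_cons alpha_prod_dalpha mul_scaleA.
  by rewrite [iter _ al r.2]family_fun_iter_alpha.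
rewrite (@eq_sh _ _ gsign _ w (fun A B => sum_tilde al rho (D_kernel A B))
  (fun A B => sh B (Th A) + sh B (Ps A)) step).
apply: etrans (shD _ _ _ _) _.
have e1 := sh_assoc gsign w Th; have e2 := sh_assoc gsign w Ps.
apply: etrans (congr2 +%R (esym e1) (esym e2)) _.
suff e3 : sh w (fun Y E => sh Y (fun A C => Ps A C E)) = 0.
  apply: etrans (congr2 +%R (erefl _) e3) _; apply: etrans (addr0 _) _.
  apply: eq_sh => Y E _; rewrite /jacobiator (sh_comp _ _ _ (@iota_linear K V)).
  rewrite (sh_comp _ _ _ (mulr_left_linear (aprod (size Y).-1 E))).
  by apply: eq_sh => A C /perm_size; rewrite size_cat /Th => ->.
apply: sh0 => Y E YE; have /dhomog_cat[hY _] := dhomog_perm YE hw.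
(* Cocommutativity shows that the sum equals its own opposite, hence is 0 in characteristic zero. *)
apply: (eq_opp_scale0 charK0); rewrite {1}sh_comm -shZ; apply: eq_sh => A C AC.
have /dhomog_cat[hA hC] := dhomog_perm AC hY.
rewrite /Ps addnC.
have [dA [hdA pA]] := family_fun_homog (map_dalpha_homog al_deg0 (n := (size C).-1) hA).
have [dC [hdC pC]] := family_fun_homog (map_dalpha_homog al_deg0 (n := (size A).-1) hC).
rewrite /= par_dalpha map_snd_dalpha in hdA pA.
rewrite /= par_dalpha map_snd_dalpha in hdC pC.
apply: (scale_mul_opp _ (iota_comm hdA hdC)).
by rewrite -pA -pC; case: (par A) (par C) => -[].
Qed.

(** The projection onto S^1(V) kills every term with letters left over, so the counit law isolates
    the jacobiator of the whole word. *)
Lemma sum_tilde_sq_eq0 :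
  sum_tilde al rho \o sum_tilde al rho = (fun=> 0) <->
  forall w, dhomog w -> jacobiator w = 0.
Proof.
have linD := sum_tilde_linear; split=> [DD w hw|J0].
  have [T [linT TE]] := SV_proj.
  have := congr1 T (sum_tilde_sq hw); rewrite -[X in T X = _]/((_ \o _) _) DD.
  rewrite (lin_0 linT) (sh_comp _ _ _ linT) => ->.
  rewrite -[LHS](sh_nilr gsign w (fun Y _ => jacobiator Y)).
  by apply: eq_sh => Y E _; rewrite TE.
apply: SV_linear_eq => [c x y|c x y|_ /dhomogP[w hw <-]].
- by rewrite /= !linD.
- by rewrite scaler0 addr0.
rewrite big_map /= sum_tilde_sq //; apply: sh0 => Y E YE.
by rewrite J0 ?iota0 ?mul0r //; have /dhomog_cat[] := dhomog_perm YE hw.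
Qed.

End Family.

(** The same projection recovers each operation on homogeneous words, and multilinearity does the
    rest. *)
Lemma sum_tilde_inj (rho rho' : forall n, multimap V n) :
  (forall n, (0 < n)%N ->
    [/\ multilinear (rho n), symmetric_map (rho n),
        has_degree (-1) (rho n) & commutes_with al (rho n)]) ->
  (forall n, (0 < n)%N ->
    [/\ multilinear (rho' n), symmetric_map (rho' n),
        has_degree (-1) (rho' n) & commutes_with al (rho' n)]) ->
  sum_tilde al rho = sum_tilde al rho' -> forall n, (0 < n)%N -> rho n = rho' n.
Proof.
move=> rhoP rhoP' DD' n n0; have [T [linT TE]] := SV_proj.
have TD f (fP : forall n, (0 < n)%N -> [/\ multilinear (f n), symmetric_map (f n),
    has_degree (-1) (f n) & commutes_with al (f n)]) w : dhomog w ->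
    T (sum_tilde al f (\prod_(x <- w) iota x.2)) = family_fun f (map snd w).
  move=> hw; rewrite (sum_tilde_homog fP hw) (sh_comp _ _ _ linT).
  rewrite -[RHS](sh_nilr gsign w (fun Y _ => family_fun f (map snd Y))).
  by apply: eq_sh => Y E _; rewrite TE.
have linrho m (m0 : (0 < m)%N) : multilinear (rho m) by have [] := rhoP m m0.
have linrho' m (m0 : (0 < m)%N) : multilinear (rho' m) by have [] := rhoP' m m0.
have E : family_fun rho =1 family_fun rho'.
  apply: mlin_eq; [exact: (family_fun_mlin linrho) | exact: (family_fun_mlin linrho') |].
  move=> _ /dhomogP[w hw <-]; have e := TD _ rhoP w hw.
  by rewrite DD' (TD _ rhoP' w hw) in e.
apply/funext => b; have := E (codom b).
by rewrite (family_fun_codom rho b n0) (family_fun_codom rho' b n0).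
Qed.

End Square.

(** * Desuspension *)

Lemma sign_swap (K : fieldType) (x y : K) (b c : bool) :
  x * (-1) ^+ b = (-1) ^+ c * y -> (-1) ^+ b * y = x * (-1) ^+ c.
Proof.
move=> e; have -> : y = (-1) ^+ c * (x * (-1) ^+ b) by rewrite e signrMK.
by rewrite mulrCA [x * _]mulrC signrMK mulrC.
Qed.

Lemma mlin_scale (K : fieldType) (V : gradedSpace K) (M : lmodType K)
    (F : seq V -> M) (A : seq V) (w : seq (K * V)) : mlin F ->
  F (A ++ [seq x.1 *: x.2 | x <- w]) = (\prod_(x <- w) x.1) *: F (A ++ map snd w).
Proof.
move=> linF; elim: w A => [|[c v] w IH] A /=; first by rewrite big_nil scale1r.
have FZ B : F (A ++ c *: v :: B) = c *: F (A ++ v :: B).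
  have F0 : F (A ++ 0 :: B) = 0.
    have := linF A (-1) 0 0 B.
    by rewrite scaler0 addr0 scaleN1r addNr.
  by have := linF A c v 0 B; rewrite addr0 F0 addr0.
by rewrite FZ -cat_rcons IH cat_rcons scalerA big_cons.
Qed.

Lemma multilinear_scale (K : fieldType) (V : gradedSpace K) k (f : multimap V k)
    (c : 'I_k -> K) (v : 'I_k -> V) : multilinear f ->
  f (fun i => c i *: v i) = (\prod_i c i) *: f v.
Proof.
move=> /word_fun_mlin linf.
have := mlin_scale [::] (codom (fun i => (c i, v i))) linf.
by rewrite /= !map_codom !word_fun_codom prod_codom.
Qed.

Section Twist.
Context (K : fieldType) (L : gradedSpace K).
Local Notation V := (susp L).
Local Notation par1 := (@parity K V).
Local Notation X := (bool * V)%type.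
Local Notation tau := (@tau X fst).

(* [rho_of] in a form that serves, V and L having the same carrier, for both
   directions of the suspension: it is an involution. *)
Definition twist k (f : multimap L k) : multimap L k :=
  fun v => (-1) ^+ (k * (k - 1))./2 *: f (fun i => iter (k - 1 - i) par1 (v i)).

Lemma iter_parityK n (v : V) : iter n par1 (iter n par1 v) = v.
Proof. by elim: n v => // n IH v; rewrite iterS -iterSr iterS IH parityK. Qed.

Lemma twistK k (f : multimap L k) : twist (twist f) = f.
Proof.
apply/funext => v; rewrite /twist scalerA -expr2 sqrr_sign scale1r.
by congr f; apply/funext => i; rewrite iter_parityK.
Qed.

Lemma twist_multilinear k (f : multimap L k) : multilinear f -> multilinear (twist f).
Proof.
move=> linf i a c x y; rewrite /twist.
have E z : (fun j : 'I_k => iter (k - 1 - j) par1 ([eta a with i |-> z] j)) =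
  [eta (fun j : 'I_k => iter (k - 1 - j) par1 (a j)) with i |-> iter (k - 1 - i) par1 z].
  by apply/funext => j /=; case: eqP => // ->.
rewrite !E (iter_lin (k - 1 - i) (@parity_linear K V)) linf scalerDr !scalerA.
by rewrite [_ * c]mulrC.
Qed.

(** On homogeneous arguments each power of [parity] is a sign; position i has k-1-i letters after
    it, and these signs multiply to that of [tau]. *)
Lemma twist_homog k (f : multimap L k) (d : 'I_k -> int) (v : 'I_k -> V) :
  multilinear f -> homogs d v ->
  twist f v = ((-1) ^+ (k * (k - 1))./2 *
    (-1) ^+ tau (codom (fun i => (oddz (d i), v i)))) *: f v.
Proof.
move=> linf hv; rewrite /twist -scalerA; congr (_ *: _).
have -> : (fun i : 'I_k => iter (k - 1 - i) par1 (v i)) =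
    fun i => ((-1) ^+ (odd (k - 1 - i) && oddz (d i)) : K) *: v i.
  by apply/funext => i; rewrite (iter_parity_homog _ (hv i)).
rewrite multilinear_scale //; congr (_ *: _).
elim: k {f linf} d v {hv} => [|k IH] d v.
  by rewrite big_ord0 (size0nil (size_codom_ord _)).
rewrite big_ord_recl codom_ordS /= signr_addb -IH subn1 subn0 andbC.
by rewrite size_codom_ord; congr (_ * _); apply: eq_bigr => i _; rewrite /= /bump subnDA.
Qed.

(** The vectors have degree one less in L than in V, so the skew sign in L is the [esign] of the
    decorations in V, and [decalage_perm] trades it for the Koszul sign. *)
Lemma skew_twist k (f : multimap L k) : multilinear f ->
  skew_symmetric_map f -> @symmetric_map K V k (twist f).
Proof.
move=> linf skf d v sigma hv.
have hvs : homogs (d \o sigma) (v \o sigma) by move=> i; apply: hv.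
rewrite (twist_homog linf hv) (twist_homog linf hvs).
have -> : f (v \o sigma) = skoszul K (fun i => d i - 1) sigma *: f v by apply: skf.
pose a i : X := (oddz (d i), v i).
rewrite (koszul_inv_prod (a := a)) // (skoszul_inv_prod (a := a)); last first.
  by move=> i; rewrite oddzD addbT negbK.
rewrite !scalerA; congr (_ *: _); rewrite -mulrA [RHS]mulrCA; congr (_ * _).
exact: sign_swap (decalage_perm K fst a sigma).
Qed.

Lemma sym_twist k (f : multimap L k) : multilinear f ->
  @symmetric_map K V k f -> skew_symmetric_map (twist f).
Proof.
move=> linf symf d v sigma hv.
have hv' : @homogs K V k (fun i => d i + 1) v.
  by move=> i; rewrite /homog /= addrK; apply: hv.
have hvs : @homogs K V k (fun i => d (sigma i) + 1) (v \o sigma).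
  by move=> i; apply: hv'.
rewrite (twist_homog linf hv') (twist_homog linf hvs) (symf _ _ _ hv').
pose a i : X := (oddz (d i + 1), v i).
rewrite (koszul_inv_prod (a := a)) // (skoszul_inv_prod (a := a)); last first.
  by move=> i; rewrite /= oddzD addbT.
rewrite !scalerA; congr (_ *: _); rewrite -mulrA [RHS]mulrCA; congr (_ * _).
by have := decalage_perm K fst a sigma; rewrite mulrC [RHS]mulrC.
Qed.

Lemma twist_degree_susp k (f : multimap L k) : multilinear f ->
  has_degree (k%:Z - 2) f -> @has_degree K V k (-1) (twist f).
Proof.
move=> linf degf d v hv; rewrite (twist_homog linf hv); apply: homogZ.
have := degf (fun i => d i - 1) v hv.
rewrite big_split /= sumr_const card_ord /homog /=.
(* The last -1 is the shift of the output from V to L; the k shifts of the inputs cancel the k in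
   the degree. *)
have -> : \sum_(i < k) d i + -1 *+ k + (k%:Z - 2) = \sum_(i < k) d i + -1 - 1 by lia.
exact.
Qed.

Lemma twist_degree k (f : multimap L k) : multilinear f ->
  @has_degree K V k (-1) f -> has_degree (k%:Z - 2) (twist f).
Proof.
move=> linf degf d v hv.
have hv' : @homogs K V k (fun i => d i + 1) v.
  by move=> i; rewrite /homog /= addrK; apply: hv.
rewrite (twist_homog linf hv'); apply: homogZ.
have := degf (fun i => d i + 1) v hv'.
rewrite big_split /= sumr_const card_ord /homog /=.
have -> : \sum_(i < k) d i + 1 *+ k + -1 - 1 = \sum_(i < k) d i + (k%:Z - 2) by lia.
exact.
Qed.

(** A linear map of degree 0 preserves parities, so it commutes with [parity]. *)
Lemma twist_commutes (al : L -> L) k (f : multimap L k) : linear al ->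
  (forall d v, homog d v -> homog d (al v)) ->
  commutes_with al f -> commutes_with al (twist f).
Proof.
move=> linal al0 cf v; rewrite /twist (lin_Z linal) cf; congr (_ *: f _).
apply/funext => i /=; move: (v i) => u; elim: (k - 1 - i)%N u => //= n IH u.
rewrite -IH; move: (iter _ _ _) => {}u.
elim/(@homog_ind K V): u => [x y Hx Hy|d x hx].
  have parD := lin_D (@parity_linear K V).
  by rewrite parD !(lin_D linal) parD Hx Hy.
have hax : @homog K V d (al x) by apply: al0.
by rewrite (parity_homog hx) (parity_homog hax) (lin_Z linal).
Qed.

End Twist.

(** * The HL-infinity identities and the jacobiator *)

Lemma half_mulS k : ((k.+1 * (k.+1 - 1))./2 = (k * (k - 1))./2 + k)%N.
Proof. by rewrite !subn1 -!bin2 binS bin1 addnC. Qed.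

(** Pairs in a union of two blocks: inside either block, or across. The cross term i c yields the
    sign in the HL-infinity identity. *)
Lemma half_mulD i c :
  ((i + c) * (i + c - 1))./2 = ((i * (i - 1))./2 + (c * (c - 1))./2 + i * c)%N.
Proof.
elim: c => [|c IH]; first by rewrite muln0 !addn0.
by rewrite addnS !half_mulS IH mulnS; lia.
Qed.

Section HLIdentities.
Context (K : fieldType) (L : gradedSpace K).
Local Notation V := (susp L).
Context (al : L -> L).
Local Notation X := (bool * V)%type.
Local Notation gsign := (@koszul_sign K X fst).
Local Notation esign := (@esign K X fst).
Local Notation par := (@total_parity X fst).
Local Notation tau := (@tau X fst).

Local Notation dhomog := (@dhomog K V).
Local Notation dhomog_letter := (@dhomog_letter K V).
Local Notation jacobiator := (@jacobiator K V al).
Local Notation dalpha := (@dalpha K V al).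

Context (l : forall k, multimap L k).
Arguments l : clear implicits.
Hypothesis linl : forall n, (0 < n)%N -> multilinear (l n).
Hypothesis rhoP : forall n, (0 < n)%N ->
  [/\ @multilinear K V n (rho_of l (k := n)), @symmetric_map K V n (rho_of l (k := n)),
      @has_degree K V n (-1) (rho_of l (k := n)) &
      @commutes_with K V al n (rho_of l (k := n))].

Local Notation Lf := (@family_fun K L l).
Local Notation R := (@family_fun K V (rho_of l)).

(** With i = |A| and j - 1 = |B|, the sign is (-1)^(i(j-1)). *)
Definition HL_kernel (A B : seq X) : L :=
  (-1) ^+ (odd (size A) && odd (size B)) *:
    Lf (Lf (map snd A) :: map (iter (size A).-1 al) (map snd B)).

Lemma family_fun_size w k : size w = k -> (0 < k)%N -> Lf w = l k (args w k).
Proof. by move=> <-; apply: family_fun_args. Qed.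

Lemma HL_kernel_sum n (d : 'I_n -> int) (a : 'I_n -> L) :
  \sum_(1 <= i < n.+1) \sum_(sigma : 'S_n | unshuffle i sigma)
    (let j := (n.+1 - i)%N in
     let w := codom (a \o sigma) in
     (skoszul K d sigma * (-1) ^+ (i * (j - 1))) *:
       l j (args (l i (args w i) :: map (iter (i - 1) al) (drop i w)) j))
  = sh esign (codom (fun i => (oddz (d i + 1), a i))) HL_kernel.
Proof.
pose x i : X := (oddz (d i + 1), a i); rewrite -[RHS]/(sh esign (codom x) HL_kernel).
transitivity (\sum_(1 <= i < n.+1) sh esign (codom x)
    (fun A B => if size A == i then HL_kernel A B else 0)).
  apply: eq_big_nat => i /andP[i0 ilt]; have i_n : (i <= n)%N by rewrite -ltnS.
  rewrite -(@shuffle_sum K _ esign _ _ x i HL_kernel i_n); apply: eq_bigr => sigma _.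
  rewrite (skoszul_inv_prod (a := x)); last by move=> p; rewrite /= oddzD addbT.
  cbv zeta; rewrite -scalerA; congr (_ *: _); rewrite /HL_kernel.
  set w := codom (a \o sigma); have sw : size w = n by rewrite size_codom_ord.
  have snd_x : map snd (codom (x \o sigma)) = w by rewrite map_codom.
  have st : size (take i (codom (x \o sigma))) = i.
    by rewrite size_takel // size_codom_ord.
  rewrite st size_drop size_codom_ord [map snd (take _ _)]map_take.
  rewrite [map snd (drop _ _)]map_drop snd_x.
  rewrite (@family_fun_size (take i w) i) ?size_takel ?sw // args_take.
  rewrite (@family_fun_size (_ :: _) (n.+1 - i)); last 2 first.
  - by rewrite /= size_map size_drop sw subSn.
  - by rewrite subn_gt0.
  by rewrite -signr_odd oddM subSn // !subn1.
rewrite -sh_sum; apply: eq_sh => A B /perm_size; rewrite size_cat size_codom_ord => sAB.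
have [A0|A0] := posnP (size A).
  rewrite big_nat_cond big1 => [|i /andP[/andP[i0 _] _]].
    by rewrite (size0nil A0) /HL_kernel [Lf [::]]/= (family_fun0 linl) scaler0.
  by rewrite A0 eq_sym eqn0Ngt i0.
rewrite (bigD1_seq (size A)) ?iota_uniq //=; last first.
  by rewrite mem_index_iota A0 ltnS -sAB leq_addr.
rewrite eqxx big1 ?addr0 // => i iA.
by rewrite eq_sym (negbTE iA).
Qed.

Lemma rho_of_family (w : seq X) : dhomog w ->
  R (map snd w) =
  ((-1) ^+ ((size w * (size w - 1))./2) * (-1) ^+ tau w) *: Lf (map snd w).
Proof.
case: w => [|x w]; first by rewrite scaler0.
move=> /dhomog_codom[a [d [aw ha ad]]].
have e : map snd (x :: w) = codom (snd \o a) by rewrite -map_codom aw.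
have xa : codom (fun i => (oddz (d i), (snd \o a) i)) = x :: w.
  by rewrite -[RHS]aw; apply: eq_codom => i; rewrite -ad /=; case: (a i).
rewrite e !family_fun_codom // [LHS](twist_homog (linl (ltn0Sn _)) ha).
by rewrite xa.
Qed.

Lemma tau_dalpha n (w : seq X) : tau (map (dalpha n) w) = tau w.
Proof. by elim: w => //= x w ->; rewrite size_map. Qed.

(** The outer operation has |C| + 1 arguments, and its extra (-1)^|C| cancels the one from the
    flipped parity of the inner output, leaving the sign of [tau (A ++ C)]. Then [half_mulD]
    accounts for (-1)^(|A||C|), and [decalage_sh] converts the coproduct. *)
Lemma jacobiator_HL (w : seq X) : (forall d v, @homog K V d v -> @homog K V d (al v)) ->
  dhomog w ->
  jacobiator (rho_of l) w =
  ((-1) ^+ tau w * (-1) ^+ ((size w * (size w - 1))./2)) *: sh esign w HL_kernel.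
Proof.
move=> al0 hw; rewrite -scalerA -shZ -decalage_sh; apply: eq_sh => A C AC.
have /dhomog_cat[hA hC] := dhomog_perm AC hw.
pose eA : K := (-1) ^+ ((size A * (size A - 1))./2) * (-1) ^+ tau A.
have RA : R (map snd A) = eA *: Lf (map snd A) := rho_of_family hA.
(* The inner value of l differs from that of rho by a sign only, so it has the same degree in V. *)
have hLA : dhomog_letter ((~~ par A, Lf (map snd A)) : X).
  have -> : Lf (map snd A) = eA *: R (map snd A).
    by rewrite RA scalerA /eA mulrACA -!expr2 !sqrr_sign mul1r scale1r.
  have [d [hd pd]] := family_fun_homog rhoP hA.
  by exists d; split=> //; apply: homogZ.
have linR n (n0 : (0 < n)%N) : @multilinear K V n (rho_of l (k := n)).
  by have [] := rhoP n0.
rewrite RA (family_funZ linR).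
pose C' : seq X := (~~ par A, Lf (map snd A)) :: map (dalpha (size A).-1) C.
have snd_C' : map snd C' = Lf (map snd A) :: map (iter (size A).-1 al) (map snd C).
  by rewrite /C' /= -!map_comp.
have hC' : dhomog C'.
  apply/dhomog_cons; split=> //; exact: (@map_dalpha_homog K V al al0).
have := rho_of_family hC'; rewrite snd_C' => ->.
rewrite /HL_kernel !scalerA; congr (_ *: _).
rewrite /= size_map tau_dalpha half_mulS -(perm_size AC) size_cat half_mulD.
rewrite tau_cat /eA -(signr_odd _ (_ + _)) -(signr_odd _ (_ * _)./2).
rewrite -(signr_odd _ (_ + _ + _)) -!signr_addb !oddD oddM; congr (_ ^+ _).
move: (odd (size A)) (odd (size C)) (odd _./2) (odd _./2) (par A) (tau A) (tau C).
by do 7!case.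
Qed.

Lemma HL_identity_jacobiator :
  (forall d v, @homog K V d v -> @homog K V d (al v)) ->
  (forall n, (0 < n)%N -> HL_identity al l n) <->
  (forall w : seq X, dhomog w -> jacobiator (rho_of l) w = 0).
Proof.
move=> al0; have linR n (n0 : (0 < n)%N) : @multilinear K V n (rho_of l (k := n)).
  by have [] := rhoP n0.
split=> [HL w hw|J n n0 d a ha].
  (* The identities start at n = 1; on the empty word the jacobiator is 0 because [R [::]] is. *)
  have [w0|w0] := posnP (size w).
    by rewrite (size0nil w0) /jacobiator /= (family_fun0 linR).
  rewrite jacobiator_HL //; have /dhomog_codom[a [d [aw hd ad]]] := hw.
  have := HL _ w0 (fun i => d i - 1) (snd \o a) hd; rewrite HL_kernel_sum.
  have -> : codom (fun i => (oddz (d i - 1 + 1), (snd \o a) i)) = w.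
    by rewrite -[RHS]aw; apply: eq_codom => i; rewrite subrK -ad /=; case: (a i).
  by move=> ->; rewrite scaler0.
rewrite HL_kernel_sum; set w := codom _.
have hw : dhomog w.
  apply: (@codom_dhomog K V) => i; rewrite /homog /= addrK; exact: ha.
have := J w hw; rewrite jacobiator_HL // => /eqP.
by rewrite scaler_eq0 mulf_eq0 !signr_eq0 => /eqP.
Qed.

End HLIdentities.

(** * The bijection *)

Theorem theorem7p10 (K : fieldType) (charK0 : [pchar K] =i pred0)
    (L : gradedSpace K) (alpha : {linear L -> L})
    (alpha_deg0 : forall d v, homog d v -> homog d (alpha v))
    (alpha_neq0 : exists v, alpha v <> 0) :
  let V := susp L in
  let alphaV : V -> V := @s K L \o alpha \o @sinv K L in
  set_bij [set l : forall k, multimap L k | HLinf_structure alpha l]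
          [set D : SV V -> SV V | Coder alphaV (-1) D /\ D \o D = (fun=> 0)]
          (fun l => sum_tilde alphaV (rho_of l)).
Proof.
move=> V alphaV.
have linal : linear (alpha : L -> L) by move=> c x y; rewrite linearP.
have al0 d v : @homog K V d v -> @homog K V d (alphaV v) by apply: alpha_deg0.
have rhoP l : HLinf_structure alpha l -> forall n, (0 < n)%N ->
    [/\ @multilinear K V n (rho_of l (k := n)), symmetric_map (rho_of l (k := n)),
        has_degree (-1) (rho_of l (k := n)) & commutes_with alphaV (rho_of l (k := n))].
  move=> [_ HL] n n0; have [lin deg skew comm _] := HL n n0; split.
  - exact: (@twist_multilinear K L n (l n)).
  - exact: (@skew_twist K L n (l n)).
  - exact: (@twist_degree_susp K L n (l n)).
  - exact: (@twist_commutes K L alpha n (l n)).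
split.
- move=> l HLl /=; split; first by exists (rho_of l) => //; exact: rhoP.
  apply/(sum_tilde_sq_eq0 charK0 (V := V) linal al0 (rhoP _ HLl)).
  have linl n (n0 : (0 < n)%N) : multilinear (l n) by have [] := HLl.2 n n0.
  have [J _] := HL_identity_jacobiator linl (rhoP _ HLl) al0.
  by apply: J => n n0; have [] := HLl.2 n n0.
- move=> l l'; rewrite !inE /= => HLl HLl' DD'.
  have E := sum_tilde_inj charK0 (V := V) linal al0 (rhoP _ HLl) (rhoP _ HLl') DD'.
  (* Arity 0 is fixed to 0 in any structure; in positive arity [twist] is injective, being an
     involution. *)
  apply: functional_extensionality_dep => -[|n].
    by apply/funext => a; rewrite HLl.1 HLl'.1.
  have := E n.+1 (ltn0Sn n); rewrite -(twistK (l n.+1)) -(twistK (l' n.+1)).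
  by move=> e; congr twist.
- move=> D [[rho rhoP' ->] DD].
  (* The preimage of D: [twist] undoes itself, and arity 0 gets the value that a structure
     prescribes. *)
  pose l k : multimap L k := if k is 0 then fun=> 0 else twist (rho k : multimap L k).
  have rl n : (0 < n)%N -> rho_of l (k := n) = rho n.
    by case: n => // n _; exact: (@twistK K L).
  have DE : sum_tilde alphaV (rho_of l) = sum_tilde alphaV rho.
    apply/funext => x; apply: eq_fsbigr => n; rewrite inE => n0.
    by rewrite rl.
  have rhoPl n : (0 < n)%N ->
    [/\ @multilinear K V n (rho_of l (k := n)), symmetric_map (rho_of l (k := n)),
        has_degree (-1) (rho_of l (k := n)) & commutes_with alphaV (rho_of l (k := n))].
    move=> n0; rewrite (rl n n0); exact: (rhoP' n n0).
  have linl n (n0 : (0 < n)%N) : multilinear (l n).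
    case: n n0 => [|n] n0; first by [].
    have [lin _ _ _] := rhoP' n.+1 n0.
    exact: (@twist_multilinear K L n.+1 (rho n.+1) lin).
  exists l; last exact: DE.
  split=> [a|k k0]; first by [].
  have [lin sym deg comm] := rhoP' k k0.
  have lk : l k = twist (rho k : multimap L k) by case: (k) k0.
  split; rewrite ?lk.
  + exact: (@twist_multilinear K L k (rho k)).
  + exact: (@twist_degree K L k (rho k)).
  + exact: (@sym_twist K L k (rho k)).
  + exact: (@twist_commutes K L alpha k (rho k)).
  + have [_ J] := HL_identity_jacobiator linl rhoPl al0.
    apply: J k0; apply/(sum_tilde_sq_eq0 charK0 (V := V) linal al0 rhoPl).
    by rewrite DE.
Qed.
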